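(* Consider the binary choice random coefficient model $Y=1(X'\alpha\ge0)$ with nonparametric UH $\alpha\in\mathbb{S}^{d_\alpha-1}$, independent of $X$. Suppose that either (a) the distribution of $X/|X|$ is absolutely continuous (with respect to the uniform spherical measure on $\mathbb{S}^{d_\alpha-1}$), or (b) $X=(1,\tilde X)$ and, writing $\alpha=(\alpha_1,\alpha_2')'$ with $\alpha_1$ scalar, $\alpha_2'\tilde X$ is absolutely continuous (with respect to Lebesgue measure) for every fixed value $\alpha_2\ne0$. Then the CDFs of UH, $\mathbb{E}_{\eta_0}[1(\alpha\le\alpha_r)]$ (componentwise inequality), and the quantiles of UH (the $\tau$-quantiles, $\tau\in(0,1)$, of the components of $\alpha$) are not regularly identified.
   Context: Setting: $Z=(Y,X)$ is observed; $\alpha$ (unobserved heterogeneity, UH) is unobserved, independent of $X$, normalized to $|\alpha|=1$, with $\mathbb{P}(\alpha=0)=0$; its unknown distribution $\eta_0\in H$ (a class of distributions) is absolutely continuous with respect to the uniform spherical measure on the unit sphere $\mathbb{S}^{d_\alpha-1}\subset\mathbb{R}^{d_\alpha}$. The choice probability is $\mathbb{P}(Y=1\mid X=x)=\int_{\mathbb{S}^{d_\alpha-1}}1(x'a\ge0)\,d\eta_0(a)$. $\mathbb{E}_{\eta_0}$ is expectation under $\eta_0$, and $L_2^0(\nu)$ denotes the zero-$\nu$-mean functions in $L_2(\nu)$. Whenever the $\tau$-quantile $q$ of a component $\alpha_k$ is discussed, $\alpha_k$ is assumed to be absolutely continuous with a Lebesgue density $\dot\eta_{0k}$ that is strictly positive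 in a neighborhood of $q$. Tangent space: a path $\eta_t\in H$, $t\in[0,\varepsilon)$, has score $b\in L_2(\eta_0)$ if $\int[(d\eta_t^{1/2}-d\eta_0^{1/2})/t-\tfrac12 b\,d\eta_0^{1/2}]^2\to0$ as $t\downarrow0$. $T(\eta_0)$ is the linear span of all such $b$. UH is nonparametric if $T(\eta_0)$ is dense in $L_2^0(\eta_0)$. Regular identification: the score operator is $Ab=\mathbb{E}[b(\alpha)\mid Z]$. A functional $\phi:H\to\mathbb{R}$ is differentiable with gradient (influence function) $r_\phi\in L_2^0(\eta_0)$ if $\lim_{t\to0}(\phi(\eta_t)-\phi(\eta_0))/t=\mathbb{E}_{\eta_0}[r_\phi b]$ along all such paths; for $\phi(\eta)=\mathbb{E}_\eta[r(\alpha)]$, $r_\phi=r-\phi(\eta_0)$; for the $\tau$-quantile $q$ of $\alpha_k$, $r_\phi(\alpha)=-\{1(\alpha_k<q)-\tau\}/\dot\eta_{0k}(q)$. The efficiency bound is $\sup_{b\in T(\eta_0)}(\mathbb{E}_{\eta_0}[r_\phi b])^2/\mathbb{E}[(Ab(Z))^2]$ (with $0/0=0$, $c/0=\infty$ for $c>0$). $\phi(\eta_0)$ is regularly identified if it is identified (determined by the law of $Z$ within the model) with a finite efficiency bound.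
   Formalization: Added: near some point of the sphere on the boundary of {α ≤ α_r} (resp. {α_k ≤ q}), η_0 has a positive spherical density (false without it, e.g. α_r=(2,…,2) or η_0 on separated caps); for quantiles, also that the CDF of α_k has derivative equal to its density at q. *)

(* Defs.v *)
(* MathComp-Analysis, over an arbitrary R : realType. *)
From HB Require Import structures.
From mathcomp Require Import all_boot all_order all_algebra.
From mathcomp Require Import all_classical all_reals all_analysis.

Set Implicit Arguments.
Unset Strict Implicit.
Unset Printing Implicit Defensive.

Import Order.TTheory GRing.Theory Num.Theory.
Import numFieldNormedType.Exports.

Local Open Scope classical_set_scope.
Local Open Scope ring_scope.

(* R^n is [n.-tuple R], whose library sigma-algebra, generated by the
   coordinates, is the Borel one. *)

Section euclidean.
Context {R : realType} {n : nat}.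
Implicit Types (x y a : n.-tuple R) (Q : 'M[R]_n).

Definition dot x y : R := \sum_(i < n) tnth x i * tnth y i.

Definition enorm x : R := Num.sqrt (dot x x).

Definition eball a (rho : R) : set (n.-tuple R) :=
  [set x | enorm [tuple tnth x i - tnth a i | i < n] < rho].

Definition unit_sphere : set (n.-tuple R) := [set x | enorm x = 1].

(* x / |x|; the origin is sent to itself, hence off the sphere. *)
Definition normalize x : n.-tuple R := [tuple tnth x i / enorm x | i < n].

Definition mxact Q x : n.-tuple R :=
  [tuple \sum_(j < n) Q i j * tnth x j | i < n].

(* The uniform spherical measure: the unique rotation-invariant Borel
   probability carried by the unit sphere. *)
Definition uniform_spherical (sigma : probability (n.-tuple R) R) : Prop :=
  sigma unit_sphere = 1%E /\
  forall Q, Q *m Q^T = 1%:M ->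
  forall A, measurable A -> sigma (mxact Q @^-1` A) = sigma A.

Definition orthant a : set (n.-tuple R) :=
  [set x | forall i, tnth x i <= tnth a i].

End euclidean.

Definition is_density {d} {T : measurableType d} {R : realType}
    (mu : {measure set T -> \bar R}) (nu : set T -> \bar R) (f : T -> R) :=
  [/\ measurable_fun [set: T] f, forall x, 0 <= f x &
    forall A, measurable A -> nu A = (\int[mu]_(x in A) (f x)%:E)%E].

(* L_2^0(P) *)
Definition L20 {d} {T : measurableType d} {R : realType} (P : probability T R)
    (h : T -> R) : Prop :=
  h \in Lfun P 2%:E /\ ('E_P[h] = 0)%E.

Section tangent_space.
Context {R : realType} {n : nat}.
Notation V := (n.-tuple R).
Variables (sigma : probability V R) (H : set (probability V R)).
Variable eta0 : probability V R.

(* [path] stays in H on [0, eps), starts at [eta0] and has score [b]. As all of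
   H is dominated by [sigma], d eta^{1/2} is the root of a sigma-density. *)
Definition path_with_score (path : R -> probability V R) (b : V -> R) : Prop :=
  [/\ b \in Lfun eta0 2%:E, path 0 = eta0 &
    exists2 eps : R, 0 < eps & exists f : R -> V -> R,
      (forall t, 0 <= t < eps ->
         H (path t) /\ is_density sigma (path t) (f t)) /\
      (\int[sigma]_a
         (((Num.sqrt (f t a) - Num.sqrt (f 0 a)) / t
           - 2^-1 * b a * Num.sqrt (f 0 a)) ^+ 2)%:E)%E
        @[t --> 0^'+] --> 0%E].

Definition is_score (b : V -> R) : Prop :=
  exists path, path_with_score path b.

Definition tangent_space (b : V -> R) : Prop :=
  exists (m : nat) (c : 'I_m -> R) (s : 'I_m -> V -> R),
    (forall i, is_score (s i)) /\ b = (fun a => \sum_(i < m) c i * s i a).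

Definition nonparametric : Prop :=
  forall h, L20 eta0 h -> forall e : R, 0 < e ->
  exists2 b, tangent_space b & ('E_eta0[fun a => ((h a - b a) ^+ 2)%R] < e%:E)%E.

Definition is_gradient (phi : probability V R -> R) (r : V -> R) : Prop :=
  L20 eta0 r /\
  forall path b, path_with_score path b ->
    ((phi (path t) - phi eta0) / t)%:E @[t --> 0^'+] --> ('E_eta0[(r \* b)%R])%E.

End tangent_space.

Section binary_choice.
Context {R : realType} {n : nat}.
Notation V := (n.-tuple R).

(* (x, a) |-> z = (y, x) with y = 1(x'a >= 0) *)
Definition outcome (xa : V * V) : bool * V := (0 <= dot xa.1 xa.2, xa.1).

(* X and alpha are independent with laws PX and eta. *)
Definition law_Z (PX eta : probability V R) : set (bool * V) -> \bar R :=
  pushforward (PX \x eta)%E outcome.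

(* [h] is a version of z |-> E[b(alpha) | Z = z] under [eta]. *)
Definition score_operator (PX eta : probability V R)
    (b : V -> R) (h : bool * V -> R) : Prop :=
  [/\ measurable_fun [set: bool * V] h,
      (PX \x eta)%E.-integrable [set: V * V] (EFin \o (h \o outcome)) &
      forall C, measurable C ->
        (\int[PX \x eta]_(w in outcome @^-1` C) (h (outcome w))%:E =
         \int[PX \x eta]_(w in outcome @^-1` C) (b w.2)%:E)%E].

Variables (sigma : probability V R) (H : set (probability V R)).
Variables PX eta0 : probability V R.

(* In \bar R, x / 0 = x * +oo, so that 0 / 0 = 0 and c / 0 = +oo for c > 0. *)
Definition efficiency_bound (r : V -> R) : \bar R :=
  ereal_sup [set v | exists b h,
    [/\ tangent_space sigma H eta0 b, score_operator PX eta0 b h &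
      v = ('E_eta0[(r \* b)%R] ^+ 2 /
           'E_(PX \x eta0)[fun w => (h (outcome w) ^+ 2)%R])%E]].

Definition identified (phi : probability V R -> R) : Prop :=
  forall eta, H eta ->
    (forall C, measurable C -> law_Z PX eta C = law_Z PX eta0 C) ->
    phi eta = phi eta0.

Definition regularly_identified (phi : probability V R -> R) : Prop :=
  identified phi /\
  exists2 r, is_gradient sigma H eta0 phi r & (efficiency_bound r < +oo)%E.

End binary_choice.

Section functionals.
Context {R : realType} {n : nat}.
Notation V := (n.-tuple R).

Definition cdf_at (a : V) (eta : probability V R) : R :=
  fine ('E_eta[(\1_(orthant a))%R])%E.

Definition marginal_cdf (k : 'I_n) (eta : probability V R) (x : R) : R :=
  fine (eta [set a | tnth a k <= x]).

Definition quantile (k : 'I_n) (tau : R) (eta : probability V R) : R :=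
  inf [set x | tau <= marginal_cdf k eta x].

(* The k-th component has a Lebesgue density f, positive near q. Densities are
   only defined almost everywhere; the last clause pins down the value f(q) on
   which the influence function of the quantile depends. *)
Definition regular_marginal (k : 'I_n) (eta : probability V R) (q : R) : Prop :=
  exists f : R -> R,
    [/\ is_density lebesgue_measure (pushforward eta (fun a => tnth a k)) f,
        \forall x \near q, 0 < f x &
        is_derive q 1 (marginal_cdf k eta) (f q)].

(* Some point of the sphere, near which [eta] has a positive density, lies on
   the boundary of [B] (up to null sets). Without this, 1_B may coincide
   eta-a.e. with a function in the range of the adjoint score operator: e.g.
   when [eta] is carried by two small caps, one inside and one outside [B],
   E_eta[1_B] can be regularly identified. *)
Definition charged_boundary (sigma eta : probability V R) (B : set V) : Prop :=
  exists a : V,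
    (forall rho : R, 0 < rho ->
       (0 < sigma (B `&` eball a rho))%E /\
       (0 < sigma (~` B `&` eball a rho))%E) /\
    exists (f : V -> R) (rho : R),
      [/\ is_density sigma eta f, 0 < rho &
          forall x, eball a rho x -> 0 < f x].

End functionals.

(* Main.v *)
Require Import Defs.
From HB Require Import structures.
From mathcomp Require Import all_boot all_order all_algebra.
From mathcomp Require Import all_classical all_reals all_analysis.
From mathcomp Require Import measurable_realfun ring lra.

(* If phi were regularly identified with gradient r, then
   (E[r b])^2 <= K E[(Ab)^2] for every b in the tangent space, hence, by density
   and because A is an L_2 contraction, (up to constants) for every b in
   L_2^0(eta0).  Differentiating along paths gives E[r b] = c E[1_B b] for the
   scores b, with c <> 0: B is the orthant for the CDF and {alpha_k <= q} for the
   quantile.  Take now a boundary point a0 of B and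
   b = 1_{B & U}/eta0(B & U) - 1_{U - B}/eta0(U - B) for a small ball U around
   a0.  Then E[1_B b] = 1, whereas Ab(y, x) vanishes unless the hyperplane
   orthogonal to x crosses U.  For such x both choice probabilities are bounded
   below, and the probability that the hyperplane crosses U tends to
   P(X'a0 = 0) = 0, so that E[(Ab)^2] -> 0: a contradiction. *)

Set Implicit Arguments.
Unset Strict Implicit.
Unset Printing Implicit Defensive.

Import Order.TTheory GRing.Theory Num.Theory.
Import numFieldNormedType.Exports.

Local Open Scope classical_set_scope.
Local Open Scope ring_scope.

(** * Geometry of the sphere and its uniform measure *)

Section euclidean_geometry.
Context {R : realType} {n : nat}.
Implicit Types (x y z a u : n.-tuple R) (c d : R).

(** The gradient r is never computed: only its action on scores, and by linearity on their span, is
    known. The contrast b supported in U need not belong to that span, and its L_2 norm is unbounded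
    as U shrinks. So U is fixed first, and b is then replaced by a nearby element of the tangent
    space; both E[1_B b] and E[(Ab)^2] tolerate this, being L_2-continuous in b. The lower bound on
    the choice probabilities must not deteriorate with U. It is drawn from a ball of fixed radius
    around a0 on which the density is positive: a half-space whose boundary passes close to a0
    contains, within that ball, a smaller ball centred on the sphere, of radius independent of x,
    and rotation invariance gives all these smaller balls the same spherical measure. The numerator
    of Ab is a difference of two conditional probabilities, hence at most 1 in absolute value
    however large b is. For the quantile, the defining equation is known at the true law but not
    along the path; a perturbation of order t^2 to either side replaces it by two inequalities. *)

Definition lincomb c x d y : n.-tuple R :=
  [tuple c * tnth x i + d * tnth y i | i < n].

Lemma dotC x y : dot x y = dot y x.
Proof. by apply: eq_bigr => i _; rewrite mulrC. Qed.

Lemma dot_lincombr x c y d z :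
  dot x (lincomb c y d z) = c * dot x y + d * dot x z.
Proof.
rewrite /dot !mulr_sumr -big_split/=; apply: eq_bigr => i _.
by rewrite tnth_mktuple; ring.
Qed.

Lemma dot_lincombl x c y d z :
  dot (lincomb c y d z) x = c * dot y x + d * dot z x.
Proof. by rewrite dotC dot_lincombr !(dotC x). Qed.

Lemma dot_ge0 x : 0 <= dot x x.
Proof. by apply: sumr_ge0 => i _; rewrite -expr2 sqr_ge0. Qed.

Lemma dot_eq0 x : dot x x = 0 -> forall i, tnth x i = 0.
Proof.
move=> /eqP; rewrite psumr_eq0 => [/allP x0 i|i _]; last by rewrite -expr2 sqr_ge0.
by have := x0 i (mem_index_enum i); rewrite mulf_eq0 orbb => /eqP.
Qed.

Lemma enorm_sqr x : enorm x ^+ 2 = dot x x.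
Proof. by rewrite sqr_sqrtr// dot_ge0. Qed.

Lemma enorm_ge0 x : 0 <= enorm x. Proof. exact: sqrtr_ge0. Qed.

Lemma enorm_gt0 x : (exists i, tnth x i != 0) -> 0 < enorm x.
Proof.
move=> [i]; apply: contra_neqT; rewrite -leNgt => nx.
apply: dot_eq0; rewrite -enorm_sqr.
have /eqP-> : enorm x == 0 by rewrite eq_le nx enorm_ge0.
 by rewrite expr0n/=.
Qed.

Lemma unit_sphereP x : unit_sphere x <-> dot x x = 1.
Proof.
split=> [|xx]; first by rewrite /unit_sphere/= -enorm_sqr => ->; rewrite expr1n.
by rewrite /unit_sphere/= /enorm xx sqrtr1.
Qed.

Lemma Cauchy_Schwarz_dot x y : `|dot x y| <= enorm x * enorm y.
Proof.
rewrite -[leRHS]ger0_norm ?mulr_ge0 ?enorm_ge0// -ler_sqr ?qualifE/= ?normr_ge0//.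
rewrite !real_normK ?num_real// exprMn !enorm_sqr.
have [yy|yy] := ltP 0 (dot y y).
  have := dot_ge0 (lincomb (dot y y) x (- dot x y) y).
  rewrite !dot_lincombr !dot_lincombl (dotC y x).
  set A := dot x x; set B := dot x y; set C := dot y y => H.
  rewrite -subr_ge0 -(pmulr_rge0 _ yy) -/C.
  by apply: le_trans H _; rewrite le_eqVlt; apply/orP; left; apply/eqP; ring.
have y0 : dot y y = 0 by apply/eqP; rewrite eq_le yy dot_ge0.
rewrite y0 mulr0 [dot x y]big1 ?expr0n// => i _.
by rewrite (dot_eq0 y0) mulr0.
Qed.

Lemma enorm_scale c x : enorm (lincomb c x 0 x) = `|c| * enorm x.
Proof.
rewrite /enorm dot_lincombr !dot_lincombl !mul0r !addr0 mulrA -expr2.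
by rewrite sqrtrM ?sqr_ge0// sqrtr_sqr.
Qed.

Lemma ler_enormD c x d y :
  enorm (lincomb c x d y) <= `|c| * enorm x + `|d| * enorm y.
Proof.
rewrite -[leLHS]ger0_norm ?enorm_ge0// -[leRHS]ger0_norm; last first.
  by rewrite addr_ge0// mulr_ge0// enorm_ge0.
rewrite -ler_sqr ?qualifE/= ?normr_ge0//.
rewrite !real_normK ?num_real// enorm_sqr dot_lincombr !dot_lincombl.
have := Cauchy_Schwarz_dot x y => H.
have {}H : c * d * dot x y <= `|c| * `|d| * (enorm x * enorm y).
  rewrite (le_trans (ler_norm _))// !normrM.
  by apply: ler_wpM2l => //; rewrite mulr_ge0.
rewrite (dotC y x) sqrrD !exprMn !real_normK ?num_real// !enorm_sqr.
by move: H; set A := dot x x; set B := dot x y; set C := dot y y; lra.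
Qed.

Definition tdist x y : R := enorm [tuple tnth x i - tnth y i | i < n].

Lemma tdistE x y : tdist x y = enorm (lincomb 1 x (-1) y).
Proof.
by congr enorm; apply: eq_from_tnth => i; rewrite !tnth_mktuple mul1r mulN1r.
Qed.

Lemma eballE a rho x : eball a rho x = (tdist x a < rho). Proof. by []. Qed.

Lemma tdistC x y : tdist x y = tdist y x.
Proof.
rewrite !tdistE /enorm !dot_lincombr !dot_lincombl (dotC y x).
by congr Num.sqrt; ring.
Qed.

Lemma tdist_triangle y x z : tdist x z <= tdist x y + tdist y z.
Proof.
rewrite !tdistE.
have -> : lincomb 1 x (-1) z =
    lincomb 1 (lincomb 1 x (-1) y) 1 (lincomb 1 y (-1) z).
  by apply: eq_from_tnth => i; rewrite !tnth_mktuple; ring.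
by apply: le_trans (ler_enormD _ _ _ _) _; rewrite normr1 !mul1r.
Qed.

Lemma ler_dot_tdist u x y :
  dot u x <= dot u y + enorm u * tdist x y.
Proof.
rewrite -lerBlDl tdistE.
have -> : dot u x - dot u y = dot u (lincomb 1 x (-1) y).
  by rewrite dot_lincombr; ring.
exact: le_trans (ler_norm _) (Cauchy_Schwarz_dot _ _).
Qed.

End euclidean_geometry.

(** * Measurability of the geometric sets *)

Section measurability.
Context {R : realType} {n : nat}.
Notation V := (n.-tuple R).

Lemma measurable_dot d (T : measurableType d) (f g : T -> V) :
  measurable_fun setT f -> measurable_fun setT g ->
  measurable_fun setT (fun w => dot (f w) (g w)).
Proof.
move=> /measurable_fun_tnthP mf /measurable_fun_tnthP mg.
apply: measurable_sum => i; apply: measurable_funM; [exact: mf|exact: mg].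
Qed.

Lemma measurable_sqrt : measurable_fun [set: R] (@Num.sqrt R).
Proof. by apply: continuous_measurable_fun; exact: sqrt_continuous. Qed.

Lemma measurable_enorm : measurable_fun [set: V] enorm.
Proof.
apply: (measurableT_comp measurable_sqrt).
by apply: measurable_dot; exact: measurable_id.
Qed.

Lemma measurable_lincomb c (a : V) d :
  measurable_fun [set: V] (fun x => lincomb c x d a).
Proof.
apply/measurable_fun_tnthP => i.
rewrite (_ : _ \o _ = fun x : V => c * tnth x i + d * tnth a i); last first.
  by apply/funext => x /=; rewrite tnth_mktuple.
apply: measurable_funD => //; apply: measurable_funM => //.
exact: measurable_tnth.
Qed.

Lemma measurable_eball (a : V) rho : measurable (eball a rho).
Proof.
rewrite (_ : eball a rho = (fun x => tdist x a) @^-1` `]-oo, rho[%classic); last first.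
  by apply/seteqP; split=> x /=; rewrite in_itv.
rewrite -[X in measurable X]setTI.
have m1 : measurable_fun [set: V] (fun x => tdist x a).
  under eq_fun do rewrite tdistE.
  exact: measurableT_comp measurable_enorm (measurable_lincomb _ _ _).
exact: m1.
Qed.

Lemma measurable_unit_sphere : measurable (@unit_sphere R n).
Proof.
rewrite (_ : unit_sphere = enorm @^-1` [set 1])// -[X in measurable X]setTI.
exact: measurable_enorm.
Qed.

Lemma measurable_tnth_le (k : 'I_n) (q : R) :
  measurable [set a : V | tnth a k <= q].
Proof.
rewrite (_ : [set a | _] = (fun a : V => tnth a k) @^-1` `]-oo, q]%classic); last first.
  by apply/seteqP; split=> x /=; rewrite in_itv.
by rewrite -[X in measurable X]setTI; exact: measurable_tnth.
Qed.

Lemma measurable_orthant (a : V) : measurable (orthant a).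
Proof.
rewrite (_ : orthant a = \bigcap_(i in [set: 'I_n]) [set x : V | tnth x i <= tnth a i]).
  apply: fin_bigcap_measurable => [|i _]; first exact: finite_finset.
  exact: measurable_tnth_le.
by apply/seteqP; split=> [x xa i _|x xa i]; exact: xa.
Qed.

Lemma measurable_hyperplane (a : V) : measurable [set x : V | dot x a = 0].
Proof.
rewrite (_ : [set x | _] = (fun x => dot x a) @^-1` [set 0])// -[X in measurable X]setTI.
exact: measurable_dot.
Qed.

Lemma measurable_dot_ge0 :
  measurable [set w : V * V | 0 <= dot w.1 w.2].
Proof.
rewrite (_ : [set w | _] = (fun w : V * V => dot w.1 w.2) @^-1` `[0, +oo[%classic); last first.
  by apply/seteqP; split=> x /=; rewrite in_itv/= andbT.
rewrite -[X in measurable X]setTI.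
have m1 : measurable_fun [set: V * V] (fun w : V * V => dot w.1 w.2).
  by apply: measurable_dot.
exact: m1.
Qed.

End measurability.

(** * Rotation invariance of the uniform spherical measure *)

Section rotations.
Context {R : realType} {n : nat}.
Notation V := (n.-tuple R).

(* The witness is the Householder reflection 1 - 2 v^T v / |v|^2, v = a - a', where
   the convention x / 0 = 0 yields the identity if a = a'. *)
Lemma householder (a a' : V) : unit_sphere a -> unit_sphere a' ->
  exists Q : 'M[R]_n, [/\ Q *m Q^T = 1%:M,
    forall x y, dot (mxact Q x) (mxact Q y) = dot x y,
    forall c x d y, mxact Q (lincomb c x d y) = lincomb c (mxact Q x) d (mxact Q y) &
    mxact Q a' = a].
Proof.
move=> /unit_sphereP aa /unit_sphereP aa'.
pose v := lincomb 1 a (-1) a'.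
pose c := 2 / dot v v.
pose w : 'rV[R]_n := \row_j tnth v j.
(* The one relation that makes Q orthogonal; it also holds for v = 0, where c = 0. *)
have cc : c ^+ 2 * dot v v = 2 * c.
  rewrite /c; have [->|v0] := eqVneq (dot v v) 0; first by rewrite invr0; ring.
  by field.
pose Q : 'M[R]_n := 1%:M - c *: (w^T *m w).
have QE x : mxact Q x = lincomb 1 x (- (c * dot v x)) v.
  apply: eq_from_tnth => i; rewrite !tnth_mktuple.
  transitivity (\sum_(j < n) ((i == j)%:R * tnth x j - c * tnth v i * (tnth v j * tnth x j))).
    apply: eq_bigr => j _; rewrite !mxE big_ord1 !mxE; ring.
  rewrite big_split/= sumrN -mulr_sumr -/(dot v x) (bigD1 i)//= eqxx big1 ?addr0; last first.
    by move=> j ji; rewrite eq_sym (negbTE ji) mul0r.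
  by rewrite /v tnth_mktuple mulr1n; ring.
have Qdot x y : dot (mxact Q x) (mxact Q y) = dot x y.
  rewrite !QE; move: cc; generalize c; generalize v => u e ue.
  rewrite !dot_lincombr !dot_lincombl (dotC x u).
  transitivity (dot x y + dot u x * dot u y * (e ^+ 2 * dot u u - 2 * e)); first by ring.
  by rewrite ue subrr mulr0 addr0.
exists Q; split=> //.
- have -> : Q^T = Q.
    apply/matrixP => i j; rewrite !mxE !big_ord1 !mxE eq_sym.
    by rewrite (mulrC (tnth v j)).
  rewrite /Q.
  rewrite mulmxBl mul1mx mulmxBr mulmx1 -scalemxAl -scalemxAr scalerA.
  rewrite mulmxA -(mulmxA w^T w w^T).
  have -> : w *m w^T = (dot v v)%:M.
    apply/matrixP => i j; rewrite !mxE !ord1 eqxx/= mulr1n.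
    by apply: eq_bigr => k _; rewrite !mxE.
  rewrite mul_mx_scalar -scalemxAl scalerA -expr2 cc -addrA -opprD.
  by rewrite addrCA -scalerBl (_ : c - 2 * c = - c) 1?scaleNr ?subrr ?subr0//; ring.
- move=> e x d y; rewrite !QE dot_lincombr; apply: eq_from_tnth => i.
  by rewrite !tnth_mktuple; ring.
- rewrite QE; apply: eq_from_tnth => i; rewrite !tnth_mktuple.
  have vv : dot v v = 2 - 2 * dot a a'.
    by rewrite /v !dot_lincombr !dot_lincombl aa aa' (dotC a' a); ring.
  have va : dot v a' = dot a a' - 1 by rewrite /v dot_lincombl aa'; ring.
  have [v0|v0] := eqVneq (dot v v) 0.
    rewrite /c v0 invr0.
    by have := dot_eq0 v0 i; rewrite tnth_mktuple => E; apply/eqP; rewrite -subr_eq0 -oppr_eq0; apply/eqP; lra.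
  (* For unit vectors |v|^2 = - 2 v'a', so the reflection adds exactly v = a - a' to a'. *)
  have -> : c * dot v a' = -1 by rewrite /c va; move: v0; rewrite vv => v0; field.
  by ring.
Qed.

Variable sigma : probability V R.
Hypothesis hsigma : uniform_spherical sigma.

Lemma uniform_off_sphere : sigma (~` unit_sphere) = 0%E.
Proof. by rewrite probability_setC ?hsigma.1 ?subee//; exact: measurable_unit_sphere. Qed.

Lemma uniform_eball (a a' : V) rho : unit_sphere a -> unit_sphere a' ->
  sigma (eball a rho) = sigma (eball a' rho).
Proof.
move=> sa sa'; have [Q [QQ Qdot Qlin Qa]] := householder sa sa'.
rewrite -(hsigma.2 _ QQ _ (measurable_eball _ _)); congr (sigma _).
apply/seteqP; split=> x; rewrite /preimage/= !eballE !tdistE -{1}Qa -Qlin /enorm;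
  by rewrite Qdot.
Qed.

Lemma uniform_hyperplane_eq (a a' : V) : unit_sphere a -> unit_sphere a' ->
  sigma [set x | dot x a = 0] = sigma [set x | dot x a' = 0].
Proof.
move=> sa sa'; have [Q [QQ Qdot Qlin Qa]] := householder sa sa'.
rewrite -(hsigma.2 _ QQ _ (measurable_hyperplane _)); congr (sigma _).
by apply/seteqP; split=> x /=; rewrite -{1}Qa Qdot.
Qed.

End rotations.

(** * Hyperplanes through the origin are spherically null *)

Section hyperplane.
Context {R : realType} {m : nat}.
Notation V := (m.+1.-tuple R).

(* Points on the moment curve: any m+1 of them are linearly independent, so that
   a nonzero x is orthogonal to at most m of them. *)
Definition moment (t : R) : V := [tuple t ^+ i | i < m.+1].

(** As a function of t, [dot x (moment t)] is a nonzero polynomial of degree at most m with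
    coefficients x, and the integers j are distinct candidates for its roots. *)
Lemma count_moment_hyperplanes (x : V) (N : nat) : (exists i, tnth x i != 0) ->
  (\sum_(j < N) \1_[set y : V | dot y (moment j%:R) = 0] x <= m%:R :> R).
Proof.
move=> [i xi].
pose p : {poly R} := \poly_(k < m.+1) tnth x (inord k).
have p0 : p != 0.
  apply: contra_neq xi => p0; have : p`_i = 0 by rewrite p0 coef0.
  by rewrite coef_poly ltn_ord inord_val.
have pE t : p.[t] = dot x (moment t).
  rewrite horner_poly; apply: eq_bigr => k _.
  by rewrite inord_val tnth_mktuple.
pose rs := [seq (val j)%:R : R | j <- enum [pred j : 'I_N | dot x (moment j%:R) == 0]].
have urs : uniq rs.
  rewrite map_inj_uniq ?enum_uniq//.
  by move=> j k /eqP; rewrite eqr_nat => /eqP /val_inj.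
have rrs : all (root p) rs.
  apply/allP => _ /mapP[j + ->]; rewrite mem_enum => j0.
  by rewrite rootE pE.
have := max_poly_roots p0 rrs urs.
rewrite size_map -cardE => /leq_trans/(_ (size_poly _ _)); rewrite ltnS => h.
rewrite (_ : \sum_(j < N) _ = #|[pred j : 'I_N | dot x (moment j%:R) == 0]|%:R) ?ler_nat//.
rewrite -sum1_card natr_sum [RHS]big_mkcond/=; apply: eq_bigr => j _.
rewrite indicE; case: ifPn => [/eqP|] xj; first by rewrite mem_set.
by rewrite memNset//=; apply/eqP.
Qed.

Variable sigma : probability V R.
Hypothesis hsigma : uniform_spherical sigma.

(* All hyperplanes through 0 have the same measure s, and N of them, orthogonal to
   points of the moment curve, cover each point at most m times: N s <= m. *)
Lemma uniform_hyperplane (a : V) : unit_sphere a ->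
  sigma [set x | dot x a = 0] = 0%E.
Proof.
move=> sa; set s := sigma _.
have sfin : s \is a fin_num by exact: fin_num_measure (measurable_hyperplane _).
have sE (t : R) : sigma [set x | dot x (moment t) = 0] = s.
  have n0 : 0 < enorm (moment t).
    by apply: enorm_gt0; exists ord0; rewrite tnth_mktuple expr0 oner_eq0.
  pose u := lincomb (enorm (moment t))^-1 (moment t) 0 (moment t).
  have su : unit_sphere u.
    rewrite /unit_sphere/= enorm_scale ger0_norm ?invr_ge0 ?ltW//.
    by rewrite mulVf ?gt_eqF.
  rewrite /s (uniform_hyperplane_eq hsigma sa su); congr (sigma _).
  apply/seteqP; split=> x /=; rewrite dot_lincombr mul0r addr0.
    by move=> ->; rewrite mulr0.
  by move/eqP; rewrite mulf_eq0 invr_eq0 gt_eqF//= => /eqP.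
have bnd (N : nat) : (N%:R%:E * s <= m%:R%:E)%E.
  (* The integral is taken over the sphere, which has full measure, because the counting bound
     requires x nonzero: the origin lies on all N hyperplanes. *)
  have -> : (N%:R%:E * s = \int[sigma]_(x in unit_sphere)
      (\sum_(j < N) \1_[set y : V | dot y (moment j%:R) = 0] x)%:E)%E.
    under eq_integral do rewrite -sumEFin.
    rewrite ge0_integral_sum//; first last.
    - move=> j; apply/measurable_EFinP; apply: measurable_indic.
      exact: measurable_hyperplane.
    - exact: measurable_unit_sphere.
    rewrite (eq_bigr (fun=> s)) => [|j _].
      by rewrite -(fineK sfin) sumEFin sumr_const card_ord -EFinM mulr_natl.
    rewrite integral_indic ?sE//; [|exact: measurable_unit_sphere|exact: measurable_hyperplane].
    rewrite -[RHS](sE j%:R).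
    rewrite [RHS](measureDI sigma (measurable_hyperplane _) measurable_unit_sphere).
    rewrite -[LHS]add0e; congr (_ + _)%E; apply/esym.
    apply: (subset_measure0 (B := ~` unit_sphere)) (uniform_off_sphere hsigma) => [||x []//].
      by apply: measurableD; [exact: measurable_hyperplane|exact: measurable_unit_sphere].
    by apply: measurableC; exact: measurable_unit_sphere.
  apply: (@le_trans _ _ (\int[sigma]_(x in unit_sphere) (m%:R : R)%:E)%E).
    apply: ge0_le_integral => //.
    - exact: measurable_unit_sphere.
    - by move=> x _; rewrite lee_fin sumr_ge0.
    - apply/measurable_EFinP; apply: measurable_sum => j; apply: measurable_indic.
      exact: measurable_hyperplane.
    - move=> x /unit_sphereP xx; rewrite lee_fin; apply: count_moment_hyperplanes.
      apply: contrapT => /forallNP x0; move: xx; rewrite /dot big1 => [/eqP|i _].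
        by rewrite eq_sym oner_eq0.
      by have /negP := x0 i; rewrite negbK => /eqP->; rewrite mul0r.
  rewrite integral_cst; last exact: measurable_unit_sphere.
  by rewrite -[leRHS]mule1 lee_wpmul2l ?lee_fin// probability_le1//; exact: measurable_unit_sphere.
have s0 : (0 <= s)%E by exact: measure_ge0.
rewrite -(fineK sfin) in s0 bnd *; congr (_%:E); apply/eqP.
rewrite eq_le; apply/andP; split; last by rewrite -lee_fin.
rewrite leNgt; apply/negP => sp.
have := bnd (Num.truncn (m%:R / fine s)).+1.
rewrite -EFinM lee_fin leNgt => /negP; apply.
by rewrite -ltr_pdivrMr// truncnS_gt.
Qed.

End hyperplane.

(** * Integration preliminaries *)

Section integral_facts.
Context d (T : measurableType d) (R : realType).
Variable mu : {measure set T -> \bar R}.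

Lemma integral_indicM (D : set T) (f : T -> R) : measurable D ->
  (\int[mu]_(x in D) (f x)%:E = \int[mu]_x (\1_D x * f x)%:E)%E.
Proof.
move=> mD; rewrite integral_mkcond; apply: eq_integral => x _.
by rewrite patchE indicE; case: ifPn => _; rewrite ?mul1r ?mul0r.
Qed.

Lemma integrable_indicM (D : set T) (f : T -> R) : measurable D ->
  mu.-integrable setT (EFin \o f) ->
  mu.-integrable setT (EFin \o (fun x => \1_D x * f x)).
Proof.
move=> mD intf; apply: (le_integrable measurableT _ _ intf).
  apply/measurable_EFinP/measurable_funM => //.
  by apply/measurable_EFinP; exact: measurable_int intf.
move=> x _; rewrite lee_fin normrM indicE.
by case: (_ \in _); rewrite ?normr1 ?normr0 ?mul1r ?mul0r.
Qed.

Lemma integral_cst_probability (P : probability T R) (k : \bar R) :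
  (\int[P]_x k = k)%E.
Proof.
by rewrite integral_cst// [X in (_ * X)%E](_ : _ = 1%E) ?mule1//; exact: probability_setT.
Qed.

Lemma Lfun2_integrable (P : probability T R) (f : T -> R) :
  f \in Lfun P 2%:E -> P.-integrable setT (EFin \o f).
Proof.
by move=> f2; apply/Lfun1_integrable; apply: Lfun_subset12 f2; rewrite fin_num_measure.
Qed.

Lemma EFin_Rintegral (D : set T) (f : T -> R) : measurable D ->
  mu.-integrable D (EFin \o f) ->
  ((\int[mu]_(x in D) f x)%R%:E = \int[mu]_(x in D) (f x)%:E)%E.
Proof. by move=> mD intf; rewrite /Rintegral fineK//; exact: integrable_fin_num. Qed.

Lemma Rintegral_subset (A : set T) (f : T -> R) :
  measurable A ->
  mu.-integrable setT (EFin \o f) -> (forall x, 0 <= f x) ->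
  \int[mu]_(x in A) f x <= \int[mu]_x f x.
Proof.
move=> mA intf f0; rewrite -lee_fin !EFin_Rintegral//; last exact: integrableS intf.
apply: ge0_subset_integral => //; first exact: measurable_int intf.
by move=> x _; rewrite lee_fin.
Qed.

End integral_facts.

(** * The score operator *)

Section choice_sets.
Context {R : realType} {n : nat}.
Notation V := (n.-tuple R).
Variable eta : probability V R.

Definition choice_set (x : V) (y : bool) : set V := [set a | (0 <= dot x a) = y].

Definition choice_prob (x : V) (y : bool) : R := fine (eta (choice_set x y)).

(* The version of z |-> E[b(alpha) | Z = z] which, by x / 0 = 0, vanishes where the
   choice z.1 has probability 0. *)
Definition cond_mean (b : V -> R) (z : bool * V) : R :=
  (\int[eta]_(a in choice_set z.2 z.1) b a) / choice_prob z.2 z.1.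

Lemma measurable_outcome : measurable_fun [set: V * V] (@outcome R n).
Proof.
apply: measurable_fun_pair; last exact: measurable_fst.
apply: (measurable_fun_bool true); rewrite setTI.
rewrite (_ : _ @^-1` _ = [set w : V * V | 0 <= dot w.1 w.2]); first exact: measurable_dot_ge0.
by apply/seteqP; split.
Qed.

Lemma measurable_choice (x : V) : measurable_fun [set: V] (fun a => 0 <= dot x a).
Proof.
apply: measurable_fun_ler => //.
exact: measurable_dot.
Qed.

Lemma measurable_choice_set x y : measurable (choice_set x y).
Proof.
rewrite (_ : choice_set x y = (fun a => 0 <= dot x a) @^-1` [set y])//.
by rewrite -[X in measurable X]setTI; exact: measurable_choice.
Qed.

Lemma choice_setU x : choice_set x true `|` choice_set x false = setT.
Proof.
by apply/seteqP; split=> a //= _; rewrite /choice_set/=; case: (_ <= _); [left|right].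
Qed.

Lemma disjoint_choice_set x : [disjoint choice_set x true & choice_set x false].
Proof. by apply/disj_setPS => a [/=]; rewrite /choice_set/= => ->. Qed.

Lemma integral_choice x (k : V -> R) : measurable_fun setT k ->
  (\int[eta]_a (k a)%:E = \int[eta]_(a in choice_set x true) (k a)%:E +
     \int[eta]_(a in choice_set x false) (k a)%:E)%E.
Proof.
move=> mk; rewrite -integral_setU ?choice_setU//; try exact: measurable_choice_set.
- exact/measurable_EFinP.
- exact: disjoint_choice_set.
Qed.

Lemma choice_probE x y : (choice_prob x y)%:E = eta (choice_set x y).
Proof. by rewrite fineK//; exact: fin_num_measure (measurable_choice_set _ _). Qed.

Lemma choice_prob_ge0 x y : 0 <= choice_prob x y.
Proof. by rewrite fine_ge0. Qed.

(** The default value of [cond_mean] is harmless: where the choice has probability 0, the integral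
    over its null set vanishes too. *)
Lemma cond_meanM (b : V -> R) x y : eta.-integrable setT (EFin \o b) ->
  cond_mean b (y, x) * choice_prob x y = \int[eta]_(a in choice_set x y) b a.
Proof.
move=> intb; rewrite /cond_mean/=.
have [p0|p0] := eqVneq (choice_prob x y) 0; last by rewrite divfK.
rewrite p0 mulr0 /Rintegral null_set_integral//; first exact: measurable_choice_set.
  by apply: measurable_funTS; exact: measurable_int intb.
transitivity (choice_prob x y)%:E; [exact/esym/choice_probE|by rewrite p0].
Qed.

(** The defining identity of the conditional expectation at a fixed x, tested against a function G
    of the choice: on each of the two choice sets G and [cond_mean] are constant. *)
Lemma integral_cond_mean x (G : bool -> R) (b : V -> R) :
  eta.-integrable setT (EFin \o b) ->
  (\int[eta]_a (G (0 <= dot x a) * cond_mean b (0 <= dot x a, x))%:E =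
   \int[eta]_a (G (0 <= dot x a) * b a)%:E)%E.
Proof.
move=> intb.
have mG (h : bool -> R) : measurable_fun setT (fun a => h (0 <= dot x a)).
  by apply: (measurableT_comp _ (measurable_choice x)).
have mb : measurable_fun setT b by apply/measurable_EFinP; exact: measurable_int intb.
rewrite !(integral_choice x); [|exact: measurable_funM|].
  suff E y : (\int[eta]_(a in choice_set x y)
        (G (0 <= dot x a) * cond_mean b (0 <= dot x a, x))%:E =
      \int[eta]_(a in choice_set x y) (G (0 <= dot x a) * b a)%:E)%E by rewrite !E.
  transitivity (\int[eta]_(a in choice_set x y) ((G y)%:E * (cond_mean b (y, x))%:E))%E.
    by apply: eq_integral => a; rewrite inE => <-.
  transitivity (\int[eta]_(a in choice_set x y) ((G y)%:E * (b a)%:E))%E; last first.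
    by apply: eq_integral => a; rewrite inE => <-.
  have mS := measurable_choice_set x y.
  rewrite integralZl//; last first.
    by apply: finite_measure_integrable_cst.
  rewrite integralZl//; last exact: integrableS intb.
  rewrite integral_cst// -EFin_Rintegral//; last exact: integrableS intb.
  congr (_ * _)%E; rewrite -cond_meanM//.
  transitivity ((cond_mean b (y, x))%:E * (choice_prob x y)%:E)%E => //.
  by rewrite choice_probE.
apply: (mG (fun y => G y * cond_mean b (y, x))).
Qed.

Variable PX : probability V R.

Lemma integrable_snd (b : V -> R) : eta.-integrable setT (EFin \o b) ->
  (PX \x eta)%E.-integrable setT (EFin \o (fun w : V * V => b w.2)).
Proof.
move=> intb; have mb := measurable_int _ intb.
apply/integrable21ltyP => /=.
  exact: measurableT_comp mb measurable_snd.
under eq_integral do rewrite integral_cst_probability.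
by move/integrableP : intb => [].
Qed.

Lemma measurable_cond_mean (b : V -> R) : eta.-integrable setT (EFin \o b) ->
  measurable_fun [set: bool * V] (cond_mean b).
Proof.
move=> intb.
have mb : measurable_fun setT b by apply/measurable_EFinP; exact: measurable_int intb.
have my (y : bool) : measurable_fun setT (fun x => cond_mean b (y, x)).
  have mS : measurable [set w : V * V | (0 <= dot w.1 w.2) = y].
    rewrite (_ : [set w | _] = @outcome R n @^-1` ([set y] `*` setT)); last first.
      by apply/seteqP; split=> w /=; [|case].
    by rewrite -[X in measurable X]setTI; apply: measurable_outcome => //; exact: measurableX.
  apply: measurable_funM.
    pose k (w : V * V) := (\1_[set w : V * V | (0 <= dot w.1 w.2) = y] w * b w.2)%:E.
    rewrite (_ : (fun x => _) = fine \o fubini_F eta k).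
      apply: measurableT_comp; first exact: fine_measurable.
      apply: (@measurable_fubini_F _ _ _ _ _ PX eta).
      exact: integrable_indicM mS (integrable_snd intb).
    apply/funext => x; rewrite /= /Rintegral integral_indicM//.
    exact: measurable_choice_set.
  (* The reciprocal is written as a power with exponent -1, which is measurable on the whole line
     and also takes the value 0 at 0. *)
  rewrite (_ : (fun x => _) = (@powR R ^~ (-1)) \o (fine \o (eta \o
      xsection [set w : V * V | (0 <= dot w.1 w.2) = y]))); last first.
    apply/funext => x /=; rewrite powR_inv1 ?fine_ge0//.
    congr (_^-1); rewrite /choice_prob; congr (fine (eta _)).
    by apply/seteqP; split=> a /=; rewrite /xsection/= inE.
  apply: measurableT_comp; first exact: measurable_powR.
  apply: measurableT_comp; first exact: fine_measurable.
  exact: measurable_fun_xsection.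
rewrite (_ : cond_mean b = fun z => if z.1 then cond_mean b (true, z.2) else cond_mean b (false, z.2)).
  apply: measurable_fun_ifT; first exact: measurable_fst.
  - exact: measurableT_comp (my true) measurable_snd.
  - exact: measurableT_comp (my false) measurable_snd.
by apply/funext => -[[]].
Qed.

(** [cond_mean b] is dominated by [cond_mean] of |b|, whose integral in a equals E|b| for every
    x. *)
Lemma integrable_cond_mean (b : V -> R) : eta.-integrable setT (EFin \o b) ->
  (PX \x eta)%E.-integrable setT (EFin \o (cond_mean b \o outcome)).
Proof.
move=> intb.
have mh : measurable_fun setT (EFin \o (cond_mean b \o @outcome R n)).
  apply/measurable_EFinP; apply: measurableT_comp measurable_outcome.
  exact: measurable_cond_mean.
have intab : eta.-integrable setT (EFin \o (fun a => `|b a|)) by exact: integrable_norm.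
apply/integrable12ltyP => //.
have le1 x a : (`|cond_mean b (outcome (x, a))| <= cond_mean (fun a => `|b a|) (outcome (x, a)))%R.
  rewrite /cond_mean normrM normfV (ger0_norm (choice_prob_ge0 _ _)).
  rewrite ler_wpM2r ?invr_ge0 ?choice_prob_ge0// le_normr_Rintegral//.
    exact: measurable_choice_set.
  by apply: integrableS intb => //; exact: measurable_choice_set.
have mho (k : V -> R) x : eta.-integrable setT (EFin \o k) ->
    measurable_fun setT (fun a => cond_mean k (outcome (x, a))).
  move=> intk; apply: (measurableT_comp (measurable_cond_mean intk)).
  exact: measurableT_comp measurable_outcome (measurable_pair1 x).
apply: (@le_lt_trans _ _ (\int[PX]_x \int[eta]_a (1 * `|b a|)%:E)%E).
  apply: ge0_le_integral => //.
  - by move=> x _; exact: integral_ge0.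
  - apply: (measurable_fun_fubini_tonelli_F (fun w => `|(cond_mean b (outcome w))%:E|%E)) => //.
    exact: measurableT_comp.
  - move=> x _.
    rewrite -(integral_cond_mean x (fun=> 1) intab).
    apply: ge0_le_integral => //.
    + apply/measurable_EFinP; apply: measurableT_comp => //; exact: mho.
    + apply/measurable_EFinP; apply: measurable_funM => //; exact: (mho _ x intab).
    + by move=> a _; rewrite /= lee_fin mul1r le1.
rewrite integral_cst_probability.
under eq_integral do rewrite mul1r.
by move/integrableP : intb => [].
Qed.

(** By Fubini the identity is checked at each x, with the indicator of the section of C as the
    weight G. The efficiency bound is a supremum over all versions of Ab, so this explicit version
    is a legitimate competitor. *)
Lemma score_operator_cond_mean (b : V -> R) : eta.-integrable setT (EFin \o b) ->
  score_operator PX eta b (cond_mean b).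
Proof.
move=> intb; split.
- exact: measurable_cond_mean.
- exact: integrable_cond_mean.
move=> C mC.
have mD : measurable (@outcome R n @^-1` C).
  by rewrite -[X in measurable X]setTI; exact: measurable_outcome.
transitivity (\int[PX \x eta]_w
    (\1_(@outcome R n @^-1` C) w * (cond_mean b \o outcome) w)%:E)%E.
  exact: integral_indicM.
transitivity (\int[PX \x eta]_w (\1_(@outcome R n @^-1` C) w * b w.2)%:E)%E; last first.
  by apply/esym; exact: (integral_indicM _ (fun w => b w.2)).
have indE x a : \1_(@outcome R n @^-1` C) (x, a) = \1_C (0 <= dot x a, x) :> R.
  by rewrite !indicE; congr (nat_of_bool _)%:R; apply/idP/idP; rewrite !inE.
have /= E1 := integral12_prod_meas1 (integrable_indicM mD (integrable_cond_mean intb)).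
have /= E2 := integral12_prod_meas1 (integrable_indicM mD (integrable_snd intb)).
rewrite -E1 -E2; apply: eq_integral => x _; rewrite /fubini_F.
transitivity (\int[eta]_a (\1_C (0 <= dot x a, x) * cond_mean b (0 <= dot x a, x))%:E)%E.
  by apply: eq_integral => a _; rewrite /= indE.
rewrite (integral_cond_mean x (fun y => \1_C (y, x)) intb).
by apply: eq_integral => a _; rewrite /= indE.
Qed.

Lemma integral_cond_mean_outcome (b : V -> R) : eta.-integrable setT (EFin \o b) ->
  (\int[PX \x eta]_w (cond_mean b (outcome w))%:E = \int[eta]_a (b a)%:E)%E.
Proof.
move=> intb; have [_ _ /(_ setT measurableT)] := score_operator_cond_mean intb.
rewrite preimage_setT => ->.
have /= <- := integral12_prod_meas1 (integrable_snd intb).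
by rewrite /fubini_F/= integral_cst_probability.
Qed.

Lemma cond_meanB (b c : V -> R) z : eta.-integrable setT (EFin \o b) ->
  eta.-integrable setT (EFin \o c) ->
  cond_mean (fun a => b a - c a) z = cond_mean b z - cond_mean c z.
Proof.
move=> intb intc; have mS := measurable_choice_set z.2 z.1.
by rewrite /cond_mean RintegralB ?mulrBl//; exact: integrableS measurableT _ _ _.
Qed.

(** Conditional Jensen inequality: integrate (b - c)^2 >= 0 over the choice set, c being the mean of
    b there. *)
Lemma cond_mean_sqr (b : V -> R) z : b \in Lfun eta 2%:E ->
  cond_mean b z ^+ 2 <= cond_mean (fun a => b a ^+ 2) z.
Proof.
move=> b2; have int2 := Lfun2_integrable_sqr b2.
have int1 := Lfun2_integrable b2.
have mS := measurable_choice_set z.2 z.1.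
set c := cond_mean b z.
have [p0|p0] := eqVneq (choice_prob z.2 z.1) 0.
  by rewrite /c /cond_mean p0 invr0 !mulr0 expr0n.
have intS (k : V -> R) : eta.-integrable setT (EFin \o k) ->
  eta.-integrable (choice_set z.2 z.1) (EFin \o k) by move=> ?; exact: integrableS measurableT _ _ _.
have h : 0 <= \int[eta]_(a in choice_set z.2 z.1) (b a ^+ 2 - ((2 * c) * b a - c ^+ 2)).
  by apply: Rintegral_ge0 => a _; rewrite (_ : _ - _ = (b a - c) ^+ 2) ?sqr_ge0//; ring.
have ic : eta.-integrable setT (EFin \o (fun=> c ^+ 2)) by exact: finite_measure_integrable_cst.
have ib : eta.-integrable setT (EFin \o (fun a => 2 * c * b a)).
  rewrite (_ : _ \o _ = fun a => ((2 * c)%:E * (b a)%:E)%E) //; exact: integrableZl.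
have pE : \int[eta]_(a in choice_set z.2 z.1) b a = c * choice_prob z.2 z.1.
  by rewrite /c /cond_mean divfK.
rewrite RintegralB in h => //; [|exact: intS|]; last first.
  by apply: (intS); exact: (integrableB _ ib ic).
rewrite RintegralB in h; [|by []|exact: intS|exact: intS].
rewrite RintegralZl in h; [|by []|exact: intS].
rewrite Rintegral_cst// pE in h.
rewrite /cond_mean ler_pdivlMr; last by rewrite lt_neqAle eq_sym p0 choice_prob_ge0.
move: h; rewrite -/(choice_prob z.2 z.1); lra.
Qed.

(** Lets an element b of the tangent space inherit a small E[(Ab)^2] from an L_2-close test function
    c. It combines y^2 <= 2 x^2 + 2 (x - y)^2, which is (2 x - y)^2 >= 0, with Jensen for c - b. *)
Lemma le_expectation_cond_mean_sqr (b c : V -> R) :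
  b \in Lfun eta 2%:E -> c \in Lfun eta 2%:E ->
  ('E_(PX \x eta)[fun w => (cond_mean b (outcome w) ^+ 2)%R] <=
    2%:E * 'E_(PX \x eta)[fun w => (cond_mean c (outcome w) ^+ 2)%R] +
    2%:E * 'E_eta[fun a => ((c a - b a) ^+ 2)%R])%E.
Proof.
move=> b2 c2; rewrite !unlock.
have int1 k : k \in Lfun eta 2%:E -> eta.-integrable setT (EFin \o k).
  by move=> k2; exact: Lfun2_integrable.
have d2 : (fun a => c a - b a) \in Lfun eta 2%:E.
  by rewrite (_ : (fun a => _) = c - b)// rpredB// lee1n.
have intd := Lfun2_integrable_sqr d2.
rewrite -(integral_cond_mean_outcome intd).
have mo k : eta.-integrable setT (EFin \o k) -> measurable_fun setT (fun w => cond_mean k (@outcome R n w)).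
  by move=> intk; exact: measurableT_comp (measurable_cond_mean intk) measurable_outcome.
have m2 k : k \in Lfun eta 2%:E -> measurable_fun setT (fun w => (cond_mean k (@outcome R n w) ^+ 2)%:E).
  by move=> k2; apply/measurable_EFinP; apply: measurable_funX; apply: mo; exact: int1.
have md : measurable_fun setT
    (fun w => (cond_mean (fun a => (c a - b a) ^+ 2) (@outcome R n w))%:E).
  by apply/measurable_EFinP; exact: mo.
have dpos w : 0 <= cond_mean (fun a => (c a - b a) ^+ 2) w.
  by rewrite divr_ge0 ?choice_prob_ge0// Rintegral_ge0// => a _; exact: sqr_ge0.
rewrite -!ge0_integralZl//; try by move=> *; rewrite lee_fin ?sqr_ge0.
- rewrite -ge0_integralD//.
  + apply: ge0_le_integral => //.
    * by move=> w _; rewrite lee_fin sqr_ge0.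
    * exact: m2.
    * apply: emeasurable_funD; apply: measurable_funeM; [exact: m2|exact: md].
    * move=> w _; rewrite -!EFinM -EFinD lee_fin.
      have := cond_mean_sqr (outcome w) d2; rewrite (cond_meanB _ (int1 _ c2) (int1 _ b2)).
      set x := cond_mean c _; set y := cond_mean b _; set u := cond_mean _ _.
      move=> h; have := sqr_ge0 (2 * x - y); lra.
  + by move=> w _; rewrite mule_ge0// lee_fin sqr_ge0.
  + by apply: measurable_funeM; exact: m2.
  + by move=> w _; rewrite mule_ge0// lee_fin.
  + by apply: measurable_funeM; exact: md.
- exact: m2.
Qed.

End choice_sets.

(** * Differentiation along paths *)

Section density.
Context d (T : measurableType d) (R : realType).
Variables (mu P : probability T R) (f : T -> R).
Hypothesis fP : is_density mu P f.

Let f0 x : 0 <= f x. Proof. by case: fP. Qed.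
Let mf : measurable_fun setT f. Proof. by case: fP. Qed.
Let fE A : measurable A -> P A = (\int[mu]_(x in A) (f x)%:E)%E.
Proof. by case: fP => _ _; exact. Qed.

Lemma density_dominates : P `<< mu.
Proof.
apply/null_content_dominatesP => A mA A0; rewrite fE//.
by apply: null_set_integral => //; exact/measurable_EFinP/measurable_funTS.
Qed.

Lemma integral_densityT : (\int[mu]_x (f x)%:E = 1)%E.
Proof. by rewrite -fE//; exact: probability_setT. Qed.

Lemma integrable_density : mu.-integrable setT (EFin \o f).
Proof.
apply/integrableP; split; first exact/measurable_EFinP.
under eq_integral do rewrite /= ger0_norm//.
by rewrite integral_densityT ltry.
Qed.

(** [is_density] speaks of measures of sets only; identifying f with the Radon-Nikodym derivative
    makes the change of variables available for signed integrands. *)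
Lemma Radon_Nikodym_density :
  ae_eq mu setT (Radon_Nikodym (charge_of_finite_measure P) mu) (EFin \o f).
Proof.
apply: integral_ae_eq => //.
- by apply: Radon_Nikodym_integrable; exact: density_dominates.
- exact/measurable_EFinP.
- move=> A _ mA; rewrite -Radon_Nikodym_integral//; last exact: density_dominates.
  exact: fE.
Qed.

Lemma integral_densityM (g : T -> R) : P.-integrable setT (EFin \o g) ->
  (\int[P]_x (g x)%:E = \int[mu]_x (g x * f x)%:E)%E.
Proof.
move=> intg; have mg := measurable_int _ intg.
rewrite -(Radon_Nikodym_change_of_variables density_dominates measurableT intg).
apply: ae_eq_integral => //.
- apply: emeasurable_funM => //.
  apply: (measurable_int mu); apply: Radon_Nikodym_integrable; exact: density_dominates.
- by apply/measurable_EFinP/measurable_funM => //; exact/measurable_EFinP.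
- by apply: filterS Radon_Nikodym_density => x /= /[apply] ->.
Qed.

Lemma integral_densityM_in (A : set T) (g : T -> R) : measurable A ->
  P.-integrable setT (EFin \o g) ->
  (\int[P]_(x in A) (g x)%:E = \int[mu]_(x in A) (g x * f x)%:E)%E.
Proof.
move=> mA intg.
rewrite (integral_indicM P g mA) (integral_indicM mu (fun x => g x * f x) mA).
rewrite (@integral_densityM (fun x => \1_A x * g x)); last exact: integrable_indicM.
by apply: eq_integral => x _; rewrite /= mulrA.
Qed.

Lemma integrable_densityM (g : T -> R) : P.-integrable setT (EFin \o g) ->
  mu.-integrable setT (EFin \o (fun x => g x * f x)).
Proof.
move=> intg; have mg := measurable_int _ intg.
apply/integrableP; split.
  by apply/measurable_EFinP/measurable_funM => //; exact/measurable_EFinP.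
under eq_integral do rewrite /= normrM (ger0_norm (f0 _)).
rewrite -(@integral_densityM (fun x => `|g x|)); last exact: integrable_norm.
by move/integrableP : intg => [].
Qed.

End density.

Section score_remainder.
Context {R : realType}.

(* With [q] the remainder of the difference quotient of the root density, the
   quotient of the density itself is off by
   [q (x + y) + t (b y q / 2 + (b y)^2 / 4)], which AM-GM bounds. *)
Lemma score_remainder_bound (b l t x y q : R) :
  0 < l -> 0 < t -> 0 <= x -> 0 <= y ->
  q = (x - y) / t - 2^-1 * b * y ->
  `|(x ^+ 2 - y ^+ 2) / t - b * y ^+ 2| <=
    q ^+ 2 / (2 * l) + l * (x ^+ 2 + y ^+ 2) +
    t / 4 * (2 * (b ^+ 2 * y ^+ 2) + q ^+ 2).
Proof.
move=> l0 t0 x0 y0 qE.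
have xy : x = y + t * (q + 2^-1 * b * y).
  by rewrite qE; field; rewrite gt_eqF.
have -> : (x ^+ 2 - y ^+ 2) / t - b * y ^+ 2 =
    q * (x + y) + t * (2^-1 * (b * y) * q + 4^-1 * (b * y) ^+ 2).
  by rewrite xy; field; rewrite gt_eqF.
have l2 : 0 < 2 * l by rewrite mulr_gt0.
rewrite (le_trans (ler_normD _ _))//; apply: lerD.
  rewrite normrM (ger0_norm (addr_ge0 x0 y0)).
  rewrite -subr_ge0 -(pmulr_rge0 _ l2).
  have -> : q ^+ 2 = `|q| ^+ 2 by rewrite real_normK ?num_real.
  have -> : 2 * l * (`|q| ^+ 2 / (2 * l) + l * (x ^+ 2 + y ^+ 2) - `|q| * (x + y)) =
    (`|q| - l * (x + y)) ^+ 2 + l ^+ 2 * (x - y) ^+ 2.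
    by field; rewrite gt_eqF.
  by rewrite addr_ge0 ?sqr_ge0// mulr_ge0 ?sqr_ge0.
rewrite normrM (gtr0_norm t0) -[leRHS]mulrA ler_wpM2l ?(ltW t0)//.
rewrite ler_norml; apply/andP; split; rewrite -subr_ge0.
  have -> : 2^-1 * (b * y) * q + 4^-1 * (b * y) ^+ 2 -
      - (4^-1 * (2 * (b ^+ 2 * y ^+ 2) + q ^+ 2)) =
      4^-1 * (q + b * y) ^+ 2 + 2^-1 * (b * y) ^+ 2 by field.
  by apply: addr_ge0; apply: mulr_ge0; rewrite ?sqr_ge0 ?invr_ge0.
have -> : 4^-1 * (2 * (b ^+ 2 * y ^+ 2) + q ^+ 2) -
    (2^-1 * (b * y) * q + 4^-1 * (b * y) ^+ 2) =
    4^-1 * (q - b * y) ^+ 2 by field.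
by apply: mulr_ge0; rewrite ?sqr_ge0 ?invr_ge0.
Qed.

End score_remainder.

Section score_facts.
Context {R : realType} {n : nat}.
Notation V := (n.-tuple R).
Variables (sigma : probability V R) (H : set (probability V R)).
Variables (eta0 : probability V R) (path : R -> probability V R) (b : V -> R).
Hypothesis pathb : path_with_score sigma H eta0 path b.

Let b2 : b \in Lfun eta0 2%:E. Proof. by case: pathb. Qed.

Let intb : eta0.-integrable setT (EFin \o b).
Proof. exact: Lfun2_integrable. Qed.

Lemma path_with_score_H : \forall t \near 0^'+, H (path t).
Proof.
case: pathb => _ _ [eps eps0 [f [hf _]]].
near=> t; apply: (hf t _).1; apply/andP; split.
  by apply: ltW; near: t; exact: nbhs_right_gt.
by near: t; exact: nbhs_right_lt.
Unshelve. all: by end_near. Qed.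

(** Differentiability of root densities in L_2 gives differentiability of densities in L_1, hence
    uniformity over all measurable B. The quantile depends on it, because its event moves with t. *)
Lemma score_diff_quotient (e : R) : 0 < e ->
  \forall t \near 0^'+, forall B, measurable B ->
    `|(fine (path t B) - fine (eta0 B)) / t - \int[eta0]_(a in B) b a| <= e.
Proof.
move=> e0; case: pathb => _ path0 [eps eps0 [f [hf hD]]].
have hf0 : is_density sigma eta0 (f 0) by rewrite -path0; apply: (hf 0 _).2; rewrite lexx.
(* After integration the three terms of [score_remainder_bound] are at most l / 2, 2 l and l, in
   total less than 4 l = e. *)
pose l := e / 4.
have l0 : 0 < l by rewrite divr_gt0.
pose beta := \int[eta0]_a (b a ^+ 2).
have beta0 : 0 <= beta by apply: Rintegral_ge0 => a _; exact: sqr_ge0.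
pose s t a := Num.sqrt (f t a).
pose D2 t a := ((s t a - s 0 a) / t - 2^-1 * b a * s 0 a) ^+ 2.
(* The threshold l^2 controls the term divided by 2 l; the threshold 1 bounds the remainder inside
   the term with the factor t. *)
have nearD : \forall t \near 0^'+,
    (\int[sigma]_a (D2 t a)%:E < (Num.min (l ^+ 2) 1)%:E)%E.
  by apply: (hD _ (open_ereal_lt' _)); rewrite lte_fin lt_min ltr01 exprn_gt0.
near=> t => B mB.
have t0 : 0 < t by near: t; exact: nbhs_right_gt.
have te : t < eps by near: t; exact: nbhs_right_lt.
have tl : t * (2 * beta + 1) <= 4 * l.
  rewrite -ler_pdivlMr; last by rewrite ltr_wpDl// mulr_ge0.
  near: t; apply: nbhs_right_le; rewrite divr_gt0 ?mulr_gt0//.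
  by rewrite ltr_wpDl// mulr_ge0.
have Dl : (\int[sigma]_a (D2 t a)%:E < (Num.min (l ^+ 2) 1)%:E)%E.
  by near: t.
have hft : is_density sigma (path t) (f t) by apply: (hf t _).2; rewrite ltW.
have [mf0 f00 f0E] := hf0.
have [mft ft0 ftE] := hft.
have mb : measurable_fun setT b by apply/measurable_EFinP; exact: measurable_int intb.
have mD : measurable_fun setT (D2 t).
  apply: measurable_funX; apply: measurable_funB.
    by apply: measurable_funM => //; apply: measurable_funB; exact: measurableT_comp (@measurable_sqrt R) _.
  apply: measurable_funM; first exact: measurable_funM.
  exact: measurableT_comp (@measurable_sqrt R) mf0.
have intD : sigma.-integrable setT (EFin \o D2 t).
  apply/integrableP; split; first exact/measurable_EFinP.
  under eq_integral do rewrite /= ger0_norm ?sqr_ge0//.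
  exact: lt_trans Dl (ltry _).
set D := \int[sigma]_a D2 t a.
have D_lt : D < Num.min (l ^+ 2) 1 by rewrite -lte_fin EFin_Rintegral.
have D0 : 0 <= D by apply: Rintegral_ge0 => a _; exact: sqr_ge0.
have intft := integrable_density hft.
have intf0 := integrable_density hf0.
have intbf := integrable_densityM hf0 intb.
have intb2 := Lfun2_integrable_sqr b2.
have intb2f := integrable_densityM hf0 intb2.
have betaE : \int[sigma]_a (b a ^+ 2 * f 0 a) = beta.
  by apply: EFin_inj; rewrite !EFin_Rintegral// (integral_densityM hf0).
pose G a := (f t a - f 0 a) / t - b a * f 0 a.
pose W a := (D2 t a / (2 * l) + l * (f t a + f 0 a)) + t / 4 * (2 * (b a ^+ 2 * f 0 a) + D2 t a).
have iZ c (k : V -> R) : sigma.-integrable setT (EFin \o k) ->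
    sigma.-integrable setT (EFin \o (fun a => c * k a)).
  by move=> ik; rewrite (_ : _ \o _ = fun a => (c%:E * (k a)%:E)%E) //; exact: integrableZl.
have iD (k k' : V -> R) : sigma.-integrable setT (EFin \o k) ->
    sigma.-integrable setT (EFin \o k') ->
    sigma.-integrable setT (EFin \o (fun a => k a + k' a)).
  by move=> ik ik'; exact: (integrableD measurableT ik ik').
have iB (k k' : V -> R) : sigma.-integrable setT (EFin \o k) ->
    sigma.-integrable setT (EFin \o k') ->
    sigma.-integrable setT (EFin \o (fun a => k a - k' a)).
  by move=> ik ik'; exact: (integrableB measurableT ik ik').
have i1 := iB _ _ intft intf0.
have i1t : sigma.-integrable setT (EFin \o (fun a => (f t a - f 0 a) / t)).
  rewrite (_ : (fun a => _) = (fun a => t^-1 * (f t a - f 0 a))); first exact: iZ.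
  by apply/funext => a; rewrite mulrC.
have iG : sigma.-integrable setT (EFin \o G) by exact: iB.
have iDl : sigma.-integrable setT (EFin \o (fun a => D2 t a / (2 * l))).
  rewrite (_ : (fun a => _) = (fun a => (2 * l)^-1 * D2 t a)); first exact: iZ.
  by apply/funext => a; rewrite mulrC.
have iW1 := iD _ _ intft intf0.
have iW2 := iZ l _ iW1.
have iW3 := iD _ _ iDl iW2.
have iW4 := iZ 2 _ intb2f.
have iW5 := iD _ _ iW4 intD.
have iW6 := iZ (t / 4) _ iW5.
have iW : sigma.-integrable setT (EFin \o W) by exact: iD.
have GW a : `|G a| <= W a.
  have := @score_remainder_bound R (b a) _ _ _ _ _ l0 t0 (sqrtr_ge0 (f t a)) (sqrtr_ge0 (f 0 a)) erefl.
  by rewrite /G /W /D2 /s !sqr_sqrtr.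
have -> : (fine (path t B) - fine (eta0 B)) / t - \int[eta0]_(a in B) b a = \int[sigma]_(a in B) G a.
  have iS (k : V -> R) : sigma.-integrable setT (EFin \o k) ->
    sigma.-integrable B (EFin \o k) by move=> ik; exact: integrableS ik.
  rewrite /G RintegralB; [|by []|exact: iS|exact: iS].
  rewrite RintegralZr; [|by []|exact: iS].
  rewrite RintegralB; [|by []|exact: iS|exact: iS].
  rewrite ftE// f0E//; congr (_ - _).
  apply: EFin_inj; rewrite !EFin_Rintegral//; [|exact: iS|exact: integrableS intb].
  exact: (integral_densityM_in hf0 mB intb).
apply: (le_trans (le_normr_Rintegral mB (integrableS measurableT mB (@subsetT _ B) iG))).
apply: (le_trans (le_Rintegral mB _ (integrableS measurableT mB (@subsetT _ B) iW) (fun a _ => GW a))).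
  by apply: integrable_norm; exact: integrableS iG.
apply: (le_trans (Rintegral_subset mB iW (fun a => le_trans (normr_ge0 _) (GW a)))).
have ft1 : \int[sigma]_a f t a = 1 by apply: EFin_inj; rewrite EFin_Rintegral// (integral_densityT hft).
have f01 : \int[sigma]_a f 0 a = 1 by apply: EFin_inj; rewrite EFin_Rintegral// (integral_densityT hf0).
have -> : \int[sigma]_a W a = D / (2 * l) + l * 2 + t / 4 * (2 * beta + D).
  rewrite /W RintegralD// RintegralD// RintegralZr// RintegralZl// RintegralD//.
  by rewrite RintegralZl// RintegralD// RintegralZl// betaE ft1 f01.
have D_l : D < l ^+ 2 by rewrite (lt_le_trans D_lt)// ge_min lexx.
have D_1 : D < 1 by rewrite (lt_le_trans D_lt)// ge_min lexx orbT.
have : D / (2 * l) <= l / 2.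
  by rewrite ler_pdivrMr ?mulr_gt0// (le_trans (ltW D_l))// le_eqVlt; apply/orP; left; apply/eqP; field.
have : t / 4 * (2 * beta + D) <= l.
  rewrite -(ler_pM2l (_ : 0 < 4))//; apply: le_trans tl.
  rewrite mulrA (_ : 4 * (t / 4) = t); last by field.
  by rewrite ler_wpM2l ?(ltW t0)// lerD2l ltW.
by rewrite /l; lra.
Unshelve. all: by end_near. Qed.

End score_facts.

Section gradients.
Context {R : realType} {n : nat}.
Notation V := (n.-tuple R).
Variables (sigma : probability V R) (H : set (probability V R)).
Variable eta0 : probability V R.

Lemma cdf_atE (a : V) (eta : probability V R) :
  cdf_at a eta = fine (eta (orthant a)).
Proof. by rewrite /cdf_at expectation_indic//; exact: measurable_orthant. Qed.

(** Uniqueness of limits, whichever gradient r is chosen. The factor 1 gives the identity the shape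
    it shares with the quantile. *)
Lemma gradient_cdf_at (a : V) r path b :
  is_gradient sigma H eta0 (cdf_at a) r -> path_with_score sigma H eta0 path b ->
  ('E_eta0[(r \* b)%R] = (1 * \int[eta0]_(x in orthant a) b x)%R%:E)%E.
Proof.
move=> [_ gr] pb; apply: (cvg_unique (@ereal_hausdorff R) (gr _ _ pb)).
apply: cvg_EFin; first exact: nearW.
apply/cvgrPdist_le => e e0; near=> t; rewrite /= mul1r !cdf_atE distrC.
have : forall B, measurable B -> `|(fine (path t B) - fine (eta0 B)) / t - \int[eta0]_(a in B) b a| <= e.
  by near: t; exact: score_diff_quotient pb _ e0.
by apply; exact: measurable_orthant.
Unshelve. all: by end_near. Qed.

End gradients.

(** * Gradient of the quantile *)

Section quantile_gradient.
Context {R : realType}.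

(** Filling in the slope at q makes the limit unpunctured, so that it can be composed with a curve
    that may return to q. *)
Lemma is_derive_slope (F : R -> R) (q c : R) : is_derive q 1 F c ->
  (if x == q then c else (F x - F q) / (x - q)) @[x --> q] --> c.
Proof.
move=> [dF Fc].
have h : (h^-1 *: ((F \o shift q) (h *: 1) - F q)) @[h --> 0^'] --> c.
  by rewrite -Fc; exact: dF.
apply/cvgrPdist_le => e e0.
move/cvgrPdist_le : h => /(_ _ e0); rewrite near_withinE.
move/nbhs_ballP => [d /= d0 hd].
apply/nbhs_ballP; exists d => //= x; rewrite /ball/= => xd.
case: ifPn => [_|xq]; first by rewrite subrr normr0 ltW.
have := hd (x - q); rewrite /ball/= sub0r normrN distrC subr_eq0 => /(_ xd xq).
by rewrite /= /GRing.scale/= mulr1 subrK mulrC.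
Qed.

Context {n : nat}.
Notation V := (n.-tuple R).
Variables (sigma : probability V R).
Hypothesis hsigma : uniform_spherical sigma.
Variable (k : 'I_n).
Implicit Types eta : probability V R.

Lemma marginal_cdf_le eta x y : x <= y -> marginal_cdf k eta x <= marginal_cdf k eta y.
Proof.
move=> xy; rewrite fine_le ?fin_num_measure//; try exact: measurable_tnth_le.
rewrite le_measure ?inE//; try exact: measurable_tnth_le.
by move=> a /= /le_trans; exact.
Qed.

Lemma tnth_unit_sphere (a : V) : unit_sphere a -> -1 <= tnth a k <= 1.
Proof.
move=> /unit_sphereP; rewrite /dot (bigD1 k)//= => aa.
have : tnth a k * tnth a k <= 1.
  by rewrite -aa lerDl sumr_ge0// => i _; rewrite -expr2 sqr_ge0.
move=> h; rewrite -ler_norml -(@ler_pXn2r _ 2)// ?nnegrE//.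
by rewrite expr1n real_normK ?num_real// expr2.
Qed.

Lemma dominated_off_sphere eta (A : set V) : eta `<< sigma -> measurable A ->
  A `&` unit_sphere `<=` set0 -> eta A = 0%E.
Proof.
move=> /null_content_dominatesP dom mA AS; apply: dom => //.
apply: (subset_measure0 (B := ~` unit_sphere)) (uniform_off_sphere hsigma) => //.
  by apply: measurableC; exact: measurable_unit_sphere.
by move=> a Aa Sa; exact: (AS a).
Qed.

(** Components of points of the sphere lie in [-1, 1]. With the value 1 at 1, this makes the set
    that defines the quantile nonempty and bounded below, so that its infimum is genuine. *)
Lemma marginal_cdf_lt0 eta x : eta `<< sigma -> x < -1 -> marginal_cdf k eta x = 0.
Proof.
move=> dom x1; rewrite /marginal_cdf (dominated_off_sphere dom)//.
  exact: measurable_tnth_le.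
by move=> a [/= ax /tnth_unit_sphere /andP[a1 _]]; lra.
Qed.

Lemma marginal_cdf_ge1 eta : eta `<< sigma -> marginal_cdf k eta 1 = 1.
Proof.
move=> dom; have mA := measurable_tnth_le k (1 : R).
have : eta (~` [set a : V | tnth a k <= 1]) = 0%E.
  apply: (dominated_off_sphere dom); first exact: measurableC.
  by move=> a [/= ax /tnth_unit_sphere /andP[_ a1]]; exact: ax.
rewrite probability_setC// /marginal_cdf => h.
have fA : eta [set a : V | tnth a k <= 1] \is a fin_num by exact: fin_num_measure.
move: h; rewrite -(fineK fA) -EFinB => -[] /eqP; rewrite subr_eq0 => /eqP h.
by rewrite /= -h.
Qed.

Variable tau : R.
Hypothesis tau01 : 0 < tau < 1.

(** This inequality and the next ask only for domination by sigma, so they hold along the whole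
    path; the equation F(q) = tau is established under continuity. *)
Lemma marginal_cdf_gt_quantile eta x : eta `<< sigma ->
  quantile k tau eta < x -> tau <= marginal_cdf k eta x.
Proof.
move=> dom /inf_lt[|y /= ty yx]; last by rewrite (le_trans ty)// marginal_cdf_le// ltW.
by exists 1 => /=; rewrite marginal_cdf_ge1//; case/andP: tau01 => _ /ltW.
Qed.

Lemma marginal_cdf_lt_quantile eta x : eta `<< sigma ->
  x < quantile k tau eta -> marginal_cdf k eta x < tau.
Proof.
move=> dom; apply: contraTT; rewrite -!leNgt => tx; apply: ge_inf => //.
exists (-1) => y /= ty; rewrite leNgt; apply/negP => y1.
by move: ty; rewrite marginal_cdf_lt0// leNgt; case/andP: tau01 => ->.
Qed.

Lemma marginal_cdf_quantile eta : eta `<< sigma ->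
  {for quantile k tau eta, continuous (marginal_cdf k eta)} ->
  marginal_cdf k eta (quantile k tau eta) = tau.
Proof.
set q := quantile k tau eta; move=> dom /cvgrPdist_le cF.
apply/eqP; rewrite eq_le; apply/andP; split; apply/ler_addgt0Pr => e e0.
  have [x [xq xe]] : exists x, x < q /\ `|marginal_cdf k eta q - marginal_cdf k eta x| <= e.
    near q^'- => x; exists x; split; first by near: x; exact: nbhs_left_lt.
    by near: x; exact: cvg_within (cF _ e0).
  have := marginal_cdf_lt_quantile dom xq; move: xe; rewrite ler_distl; lra.
have [x [xq xe]] : exists x, q < x /\ `|marginal_cdf k eta q - marginal_cdf k eta x| <= e.
  near q^'+ => x; exists x; split; first by near: x; exact: nbhs_right_gt.
  by near: x; exact: cvg_within (cF _ e0).
have := marginal_cdf_gt_quantile dom xq; move: xe; rewrite ler_distl; lra.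
Unshelve. all: by end_near. Qed.

(* AM-GM on [D]: [2 |b| <= l b^2 + 1 / l]. *)
Lemma le_Rintegral_setD eta (b : V -> R) (A C : set V) (l : R) : 0 < l ->
  b \in Lfun eta 2%:E -> measurable A -> measurable C -> A `<=` C ->
  `|\int[eta]_(a in C) b a - \int[eta]_(a in A) b a| <=
    2^-1 * (l * (\int[eta]_a (b a ^+ 2)) + (fine (eta C) - fine (eta A)) / l).
Proof.
move=> l0 b2 mA mC AC; have int2 := Lfun2_integrable_sqr b2.
have int1 := Lfun2_integrable b2.
pose D := C `\` A.
have mD : measurable D by exact: measurableD.
have CE : C = A `|` D by rewrite setDUK.
have disj : [disjoint A & D] by apply/disj_setPS => a [/= Aa [_]].
have iS (g : V -> R) (B : set V) : measurable B -> eta.-integrable setT (EFin \o g) ->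
    eta.-integrable B (EFin \o g) by move=> mB ig; exact: integrableS ig.
rewrite {1}CE Rintegral_setU//; last by rewrite -CE; exact: iS.
rewrite [X in `|X|]addrC addKr.
have i1 : eta.-integrable setT (EFin \o (fun a => l * b a ^+ 2)).
  by rewrite (_ : _ \o _ = fun a => (l%:E * (b a ^+ 2)%:E)%E) //; exact: integrableZl.
have ic : eta.-integrable setT (EFin \o (fun=> l^-1 : R)) by exact: finite_measure_integrable_cst.
have i2 : eta.-integrable setT (EFin \o (fun a => l * b a ^+ 2 + l^-1)).
  exact: (integrableD measurableT i1 ic).
have i3 : eta.-integrable setT (EFin \o (fun a => 2^-1 * (l * b a ^+ 2 + l^-1))).
  by rewrite (_ : _ \o _ = fun a => ((2^-1)%:E * (l * b a ^+ 2 + l^-1)%:E)%E) //; exact: integrableZl.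
apply: (le_trans (le_normr_Rintegral mD (iS _ _ mD int1))).
apply: (@le_trans _ _ (\int[eta]_(a in D) (2^-1 * (l * b a ^+ 2 + l^-1)))).
  apply: le_Rintegral => //; [|exact: iS|].
    by apply: integrable_norm; exact: iS.
  move=> a _; rewrite -subr_ge0 -(pmulr_rge0 _ l0) -(@pmulr_rge0 _ 2)//.
  have bb : b a ^+ 2 = `|b a| ^+ 2 by rewrite real_normK ?num_real.
  have -> : 2 * (l * (2^-1 * (l * b a ^+ 2 + l^-1) - `|b a|)) = (l * `|b a| - 1) ^+ 2.
    by rewrite bb; field; rewrite gt_eqF.
  exact: sqr_ge0.
rewrite RintegralZl//; last exact: iS.
rewrite ler_wpM2l ?invr_ge0// RintegralD//; [|exact: iS|exact: iS].
rewrite RintegralZl//; last exact: iS.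
apply: lerD.
  rewrite ler_wpM2l ?(ltW l0)//; apply: Rintegral_subset => // a; exact: sqr_ge0.
rewrite Rintegral_cst// mulrC ler_wpM2r ?invr_ge0 ?(ltW l0)//.
have -> : fine (eta C) = fine (eta A) + fine (eta D).
  rewrite -fineD ?fin_num_measure//; congr fine; rewrite {1}CE.
  by rewrite measureU//; apply/eqP; rewrite -disj_set2E.
by rewrite [leRHS]addrAC subrr add0r.
Qed.

Lemma cvg_Rintegral_marginal eta (b : V -> R) (q : R) : b \in Lfun eta 2%:E ->
  {for q, continuous (marginal_cdf k eta)} ->
  (\int[eta]_(a in [set a | tnth a k <= x]) b a) @[x --> q] -->
    \int[eta]_(a in [set a | tnth a k <= q]) b a.
Proof.
move=> b2 /cvgrPdist_le cF; apply/cvgrPdist_le => e e0.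
set beta := \int[eta]_a (b a ^+ 2).
have beta0 : 0 <= beta by apply: Rintegral_ge0 => a _; exact: sqr_ge0.
have b1 : 0 < beta + 1 by rewrite ltr_wpDl.
(* With this l both halves of the AM-GM bound are at most e / 2, once the marginal CDF moves by at
   most e l. *)
pose l := e / (beta + 1).
have l0 : 0 < l by rewrite divr_gt0.
have lb : l * beta <= e.
  by rewrite /l mulrAC ler_pdivrMr// ler_wpM2l ?(ltW e0)// lerDl.
near=> x.
have xl : `|marginal_cdf k eta q - marginal_cdf k eta x| <= e * l.
  by near: x; apply: cF; rewrite mulr_gt0.
have [xq|qx] := leP x q.
- apply: (le_trans (le_Rintegral_setD l0 b2 _ _ _)).
  + exact: measurable_tnth_le.
  + exact: measurable_tnth_le.
  + by move=> a /= /le_trans; exact.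
  rewrite -/beta -/(marginal_cdf k eta q) -/(marginal_cdf k eta x).
  have : (marginal_cdf k eta q - marginal_cdf k eta x) / l <= e.
    by rewrite ler_pdivrMr// (le_trans (ler_norm _)).
  lra.
- rewrite distrC; apply: (le_trans (le_Rintegral_setD l0 b2 _ _ _)).
  + exact: measurable_tnth_le.
  + exact: measurable_tnth_le.
  + by move=> a /= /le_trans; apply; exact: ltW.
  rewrite -/beta -/(marginal_cdf k eta q) -/(marginal_cdf k eta x).
  have : (marginal_cdf k eta x - marginal_cdf k eta q) / l <= e.
    by rewrite ler_pdivrMr// (le_trans (ler_norm _))// distrC.
  lra.
Unshelve. all: by end_near. Qed.

Variables (H : set (probability V R)) (eta0 : probability V R).
Hypothesis hH : forall eta, H eta -> eta `<< sigma.
Hypothesis heta0 : H eta0.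

(* x t stands for the quantile of [path t], perturbed by +t^2 or -t^2. *)
Lemma cvg_marginal_cdf_path path b (q c L : R) (x : R -> R) :
  path_with_score sigma H eta0 path b ->
  is_derive q 1 (marginal_cdf k eta0) c ->
  (x t - q) / t @[t --> 0^'+] --> L ->
  (marginal_cdf k (path t) (x t) - marginal_cdf k eta0 q) / t @[t --> 0^'+] -->
    \int[eta0]_(a in [set a | tnth a k <= q]) b a + L * c.
Proof.
move=> pb dF xL.
have b2 : b \in Lfun eta0 2%:E by case: pb.
have cF : {for q, continuous (marginal_cdf k eta0)}.
  by apply: differentiable_continuous; apply/derivable1_diffP; exact: ex_derive.
have t0 : t @[t --> 0^'+] --> (0 : R) by apply: cvg_at_right_filter; exact: cvg_id.
have xq : x t @[t --> 0^'+] --> q.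
  have : (x t - q) / t * t + q @[t --> 0^'+] --> L * 0 + q.
    by apply: cvgD; [exact: cvgM|exact: cvg_cst].
  rewrite mulr0 add0r; apply: cvg_trans; apply: near_eq_cvg.
  near=> t; rewrite divfK ?subrK// gt_eqF//.
(* The quotient splits into the change of law at the moving point x t, which [score_diff_quotient]
   controls uniformly in the event, and the change of point under the fixed law eta0. *)
have h1 : (marginal_cdf k (path t) (x t) - marginal_cdf k eta0 (x t)) / t -
    \int[eta0]_(a in [set a | tnth a k <= x t]) b a @[t --> 0^'+] --> (0 : R).
  apply/cvgrPdist_le => e e0; near=> t; rewrite sub0r normrN.
  have : forall B, measurable B ->
      `|(fine (path t B) - fine (eta0 B)) / t - \int[eta0]_(a in B) b a| <= e.
    by near: t; exact: score_diff_quotient pb _ e0.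
  by apply; exact: measurable_tnth_le.
have h2 : \int[eta0]_(a in [set a | tnth a k <= x t]) b a @[t --> 0^'+] -->
    \int[eta0]_(a in [set a | tnth a k <= q]) b a.
  exact: cvg_comp xq (cvg_Rintegral_marginal b2 cF).
pose g y := if y == q then c else (marginal_cdf k eta0 y - marginal_cdf k eta0 q) / (y - q).
have h3 : (x t - q) / t * g (x t) @[t --> 0^'+] --> L * c.
  by apply: cvgM xL _; exact: cvg_comp xq (is_derive_slope dF).
have : (marginal_cdf k (path t) (x t) - marginal_cdf k eta0 (x t)) / t -
    \int[eta0]_(a in [set a | tnth a k <= x t]) b a +
    \int[eta0]_(a in [set a | tnth a k <= x t]) b a +
    (x t - q) / t * g (x t) @[t --> 0^'+] -->
    0 + \int[eta0]_(a in [set a | tnth a k <= q]) b a + L * c.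
  by apply: cvgD h3; exact: cvgD.
rewrite add0r; apply: cvg_trans; apply: near_eq_cvg.
near=> t; rewrite subrK.
have tt : 0 < t by near: t; exact: nbhs_right_gt.
have -> : (x t - q) / t * g (x t) = (marginal_cdf k eta0 (x t) - marginal_cdf k eta0 q) / t.
  rewrite /g; case: eqVneq => [->|xtq]; first by rewrite !subrr !mul0r.
  by field; rewrite subr_eq0 xtq gt_eqF.
by rewrite -mulrDl addrA subrK.
Unshelve. all: by end_near. Qed.

(** Implicit differentiation. The gradient hypothesis supplies the derivative L of the quantile
    along the path, so only M + L c = 0 is to be shown. Shifting the quantile by t^2 or - t^2 keeps
    L, being o(t), but puts the point strictly to the right or left, where the marginal CDF is at
    least or below tau; the limits of the two quotients give both signs. *)
Lemma gradient_quantile r path b c : 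
  is_derive (quantile k tau eta0) 1 (marginal_cdf k eta0) c -> 0 < c ->
  is_gradient sigma H eta0 (quantile k tau) r ->
  path_with_score sigma H eta0 path b ->
  ('E_eta0[(r \* b)%R] =
    (- c^-1 * \int[eta0]_(x in [set a | tnth a k <= quantile k tau eta0]) b x)%R%:E)%E.
Proof.
set q := quantile k tau eta0; set M := \int[eta0]_(x in _) b x.
move=> dF c0 [[r2 _] gr] pb.
have b2 : b \in Lfun eta0 2%:E by case: pb.
have dom0 := hH heta0.
have Ffin : ('E_eta0[(r \* b)%R])%E \is a fin_num.
  by apply: expectation_fin_num; exact: Lfun2_mul_Lfun1.
have cF : {for q, continuous (marginal_cdf k eta0)}.
  by apply: differentiable_continuous; apply/derivable1_diffP; exact: ex_derive.
have Fq := marginal_cdf_quantile dom0 cF.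
have := gr _ _ pb; rewrite -(fineK Ffin); set L := fine _ => /fine_cvg qL.
have t0 : t @[t --> 0^'+] --> (0 : R) by apply: cvg_at_right_filter; exact: cvg_id.
have xL (s : R) : (quantile k tau (path t) + s * t ^+ 2 - q) / t @[t --> 0^'+] --> L.
  have : (quantile k tau (path t) - q) / t + s * t @[t --> 0^'+] --> L + s * 0.
    by apply: cvgD; [exact: qL|apply: cvgM => //; exact: cvg_cst].
  rewrite mulr0 addr0; apply: cvg_trans; apply: near_eq_cvg.
  near=> t; field; rewrite gt_eqF//.
have nH := path_with_score_H pb.
have h (s : R) := cvg_marginal_cdf_path pb dF (xL s).
have hge : 0 <= M + L * c.
  apply: (cvgr_to_ge (h 1)); near=> t.
  have tt : 0 < t by near: t; exact: nbhs_right_gt.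
  rewrite divr_ge0 ?(ltW tt)// subr_ge0 -/q Fq.
  apply: marginal_cdf_gt_quantile; first by apply: hH; near: t.
  by rewrite mul1r ltrDl exprn_gt0.
have hle : M + L * c <= 0.
  apply: (cvgr_to_le (h (-1))); near=> t.
  have tt : 0 < t by near: t; exact: nbhs_right_gt.
  rewrite ler_pdivrMr// mul0r subr_le0 -/q Fq ltW//.
  apply: marginal_cdf_lt_quantile; first by apply: hH; near: t.
  by rewrite mulN1r gtrDl oppr_lt0 exprn_gt0.
have ML : M + L * c = 0 by apply/eqP; rewrite eq_le hle hge.
congr (_%:E); apply: (mulIf (lt0r_neq0 c0)).
by rewrite mulNr mulNr mulrAC mulVf ?gt_eqF// mul1r; apply/eqP; rewrite -subr_eq0 opprK addrC ML.
Unshelve. all: by end_near. Qed.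

End quantile_gradient.

(** * Scores concentrating at a boundary point *)

Section measure_lower_bounds.
Context d (T : measurableType d) (R : realType).

Lemma nonincreasing_measure_lt (mu : probability T R) (F : (set T)^nat) (e : R) :
  (forall i, measurable (F i)) -> nonincreasing_seq F ->
  mu (\bigcap_n F n) = 0%E -> 0 < e -> exists n, (mu (F n) < e%:E)%E.
Proof.
move=> mF nF F0 e0.
have F0fin : (mu (F 0%N) < +oo)%E by apply: (le_lt_trans (probability_le1 _ (mF _))); rewrite ltry.
have := nonincreasing_cvg_mu F0fin mF (bigcapT_measurable mF) nF.
rewrite [X in _ --> X]F0 => /(_ _ (open_ereal_lt' (_ : 0%E < e%:E)%E)).
rewrite lte_fin => /(_ e0) h.
by near \oo => n; exists n; near: n.
Unshelve. all: by end_near. Qed.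

(* Mutual absolute continuity on U, in quantitative form: f exceeds some 1 / j
   outside a subset of U of mu-measure less than s / 2. *)
Lemma density_lower_bound (mu P : probability T R) (f : T -> R) (U : set T) (s : R) :
  is_density mu P f -> measurable U -> (forall x, U x -> 0 < f x) -> 0 < s ->
  exists2 c : R, 0 < c & forall A, measurable A -> A `<=` U ->
    (s%:E <= mu A)%E -> (c%:E <= P A)%E.
Proof.
move=> [mf f0 fE] mU Uf s0.
pose F (j : nat) := U `&` f @^-1` `]-oo, (j.+1%:R^-1 : R)]%classic.
have mF j : measurable (F j).
  by apply: measurableI => //; rewrite -[X in measurable X]setTI; exact: mf.
have nF : nonincreasing_seq F.
  move=> i j ij; apply/subsetPset => x [Ux]; rewrite /= in_itv/= => fx.
  split=> //=; rewrite in_itv/= (le_trans fx)//.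
  by rewrite lef_pV2 ?posrE ?ltr0n// ler_nat ltnS.
have F0 : \bigcap_n F n = set0.
  rewrite -subset0 => x Fx; have [Ux _] := Fx 0%N I.
  have fx := Uf _ Ux.
  have [_ /=] := Fx (Num.truncn (f x)^-1) I; rewrite in_itv/= leNgt => /negP; apply.
  by rewrite -[ltRHS]invrK ltf_pV2 ?posrE ?ltr0n ?invr_gt0// truncnS_gt.
have F00 : mu (\bigcap_n F n) = 0%E by rewrite F0 measure0.
have s2 : 0 < s / 2 by rewrite divr_gt0.
have [j Fj] := nonincreasing_measure_lt mF nF F00 s2.
exists (j.+1%:R^-1 * (s / 2)); first by rewrite mulr_gt0 ?invr_gt0 ?divr_gt0.
move=> A mA AU sA.
have mG : measurable (A `\` F j) by exact: measurableD.
have G2 : ((s / 2)%:E <= mu (A `\` F j))%E.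
  have AE : mu A = (mu (A `\` F j) + mu (A `&` F j))%E by exact: measureDI.
  have le2 : (mu (A `&` F j) <= (s / 2)%:E)%E.
    by apply: le_trans (ltW Fj); apply: measureIr => //.
  move: sA; rewrite AE => sA.
  have := le_trans sA (leeD2l (mu (A `\` F j)) le2).
  have fG : mu (A `\` F j) \is a fin_num by exact: fin_num_measure.
  rewrite -(fineK fG) -EFinD !lee_fin; lra.
apply: (@le_trans _ _ (P (A `\` F j))); last first.
  by apply: le_measure; rewrite ?inE// => x [].
rewrite fE// EFinM.
apply: (@le_trans _ _ (\int[mu]_(x in A `\` F j) (j.+1%:R^-1 : R)%:E)%E).
  by rewrite integral_cst// lee_pmul// lee_fin ?invr_ge0// divr_ge0// ltW.
apply: ge0_le_integral => //.
- by apply/measurable_EFinP; exact: measurable_funTS.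
- move=> x [Ax nF']; rewrite lee_fin leNgt; apply/negP => fx; apply: nF'.
  by split; [exact: AU|rewrite /= in_itv/= ltW].
Qed.

Lemma Lfun2_indic (P : probability T R) (A : set T) : measurable A ->
  (\1_A : T -> R) \in Lfun P 2%:E.
Proof.
move=> mA; rewrite inE/=; apply/andP; split; rewrite inE//=.
rewrite /finite_norm unlock poweR_lty//.
rewrite (_ : (\int[P]_x _ = \int[P]_x (\1_A x)%:E)%E); last first.
  apply: eq_integral => x _; rewrite /= ?poweR_EFin indicE.
  case: (_ \in _); first by rewrite normr1 ?poweR_EFin powR1.
  by rewrite normr0 ?poweR_EFin powR0.
rewrite integral_indic//; apply: le_lt_trans (ltry 1).
by apply: probability_le1; exact: measurableI.
Qed.

End measure_lower_bounds.

(** * Regressors orthogonal, or nearly so, to a given direction *)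

Section boundary_null.
Context {R : realType} {m : nat}.
Notation V := (m.+1.-tuple R).
Variables (sigma PX : probability V R).
Hypothesis hsigma : uniform_spherical sigma.
Hypothesis hX : pushforward PX normalize `<< sigma \/
  (PX [set x | thead x = 1] = 1%E /\
   forall a2 : m.-tuple R, (exists i, tnth a2 i != 0) ->
     pushforward PX (fun x => dot a2 (behead_tuple x)) `<< lebesgue_measure).

(** In case (a) normalization preserves the hyperplane, the origin included. In case (b) x'a = 0
    pins a2'x to the single value - a1 if a2 is nonzero; otherwise |a1| = 1 and x'a never vanishes
    when the first regressor is 1. *)
Lemma regressor_hyperplane_null (a : V) : unit_sphere a ->
  PX [set x | dot x a = 0] = 0%E.
Proof.
move=> sa; case: hX => [/null_content_dominatesP dom|[PX1 dom]].
- have := dom _ (measurable_hyperplane a) (uniform_hyperplane hsigma sa).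
  rewrite /pushforward; congr (_ = _); congr (PX _).
  have dotE x : dot (normalize x) a = dot x a / enorm x.
    by rewrite /dot mulr_suml; apply: eq_bigr => i _; rewrite tnth_mktuple mulrAC.
  apply/seteqP; split=> x /=; rewrite dotE; last by move=> ->; rewrite mul0r.
  move/eqP; rewrite mulf_eq0 invr_eq0 => /orP[/eqP//|/eqP x0].
  have := Cauchy_Schwarz_dot x a; rewrite x0 mul0r normr_le0 => /eqP//.
- have mh : measurable [set x : V | thead x = 1].
    rewrite (_ : [set x | _] = (fun x : V => tnth x ord0) @^-1` [set 1])//.
    by rewrite -[X in measurable X]setTI; exact: measurable_tnth.
  have h0 : PX (~` [set x | thead x = 1]) = 0%E.
    by rewrite probability_setC// PX1 subee.
  have dotE (x : V) : dot x a = thead x * thead a + dot (behead_tuple a) (behead_tuple x).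
    rewrite {1}/dot big_ord_recl; congr (_ + _); rewrite dotC.
    apply: eq_bigr => i _; rewrite !tnth_behead.
    by have -> : inord i.+1 = lift ord0 i by apply/val_inj; rewrite /= inordK ?ltnS.
  have mb : measurable_fun setT (fun x : V => dot (behead_tuple a) (behead_tuple x)).
    apply: measurable_dot => //; apply/measurable_fun_tnthP => i.
    rewrite (_ : _ \o _ = fun x : V => tnth x (inord i.+1)); first exact: measurable_tnth.
    by apply/funext => x /=; rewrite tnth_behead.
  have [a2|a2] := pselect (exists i, tnth (behead_tuple a) i != 0).
  + have /null_content_dominatesP := dom _ a2.
    move=> /(_ [set - thead a] (measurable_set1 _) (lebesgue_measure_set1 _)).
    rewrite /pushforward => h1.
    apply: (subset_measure0 (B := ~` [set x | thead x = 1] `|`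
      ((fun x : V => dot (behead_tuple a) (behead_tuple x)) @^-1` [set - thead a]))).
    * exact: measurable_hyperplane.
    * apply: measurableU; first exact: measurableC.
      by rewrite -[X in measurable X]setTI; exact: mb.
    * move=> x /=; rewrite dotE => xa.
      have [x1|x1] := pselect (thead x = 1); last by left.
      by right; rewrite x1 mul1r in xa; apply/eqP; rewrite -addr_eq0 addrC xa.
    * have mB : measurable ((fun x : V => dot (behead_tuple a) (behead_tuple x)) @^-1` [set - thead a]).
        by rewrite -[X in measurable X]setTI; exact: mb.
      by rewrite -h0; exact: (measureU0 (measurableC mh) mB h1).
  + apply: (subset_measure0 (B := ~` [set x : V | thead x = 1])) => //.
    * exact: measurable_hyperplane.
    * exact: measurableC.
    * move=> x /=; rewrite dotE => xa x1; move: xa; rewrite x1 mul1r.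
      have b0 y : dot (behead_tuple a) y = 0.
        rewrite /dot big1// => i _; have -> : tnth (behead_tuple a) i = 0; last by rewrite mul0r.
        by apply/eqP; apply: contrapT => /negP ai; apply: a2; exists i.
      rewrite b0 addr0 => a0; move/unit_sphereP: sa; rewrite dotE b0 a0 mulr0 addr0 => /eqP.
      by rewrite eq_sym oner_eq0.
Qed.

(** For nonzero x, the condition says that the hyperplane orthogonal to x passes within eps' of a.
    These cones decrease to the null hyperplane as eps' tends to 0, and continuity from above
    applies. *)
Lemma regressor_near_hyperplane (a : V) (e : R) : unit_sphere a -> 0 < e ->
  exists2 eps : R, 0 < eps & forall eps', 0 < eps' <= eps ->
    measurable [set x : V | `|dot x a| <= eps' * enorm x] /\
    (PX [set x : V | (`|dot x a| <= eps' * enorm x)%R] < e%:E)%E.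
Proof.
move=> sa e0; pose D (eps : R) := [set x : V | `|dot x a| <= eps * enorm x].
have mD eps : measurable (D eps).
  rewrite (_ : D eps = (fun x => `|dot x a| <= eps * enorm x) @^-1` [set true])//.
  rewrite -[X in measurable X]setTI.
  have mle : measurable_fun [set: V] (fun x : V => `|dot x a| <= eps * enorm x).
    apply: measurable_fun_ler.
      by apply: measurableT_comp => //; exact: measurable_dot.
    by apply: measurable_funM => //; exact: measurable_enorm.
  exact: mle.
have sD eps eps' : eps <= eps' -> D eps `<=` D eps'.
  by move=> le x; rewrite /D/= => /le_trans; apply; rewrite ler_wpM2r// enorm_ge0.
pose F (j : nat) := D j.+1%:R^-1.
have nF : nonincreasing_seq F.
  move=> i j ij; apply/subsetPset; apply: sD.
  by rewrite lef_pV2 ?posrE ?ltr0n// ler_nat ltnS.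
have F0 : PX (\bigcap_n F n) = 0%E.
  rewrite -(regressor_hyperplane_null sa); congr (PX _); apply/seteqP; split=> x; last first.
    by move=> x0 j _; rewrite /F /D/= x0 normr0 mulr_ge0// enorm_ge0.
  move=> Fx /=; apply/eqP; rewrite -normr_eq0 eq_le normr_ge0 andbT leNgt; apply/negP => xa.
  have := Fx (Num.truncn (enorm x / `|dot x a|)) I; rewrite /F /D/= leNgt => /negP; apply.
  by rewrite mulrC ltr_pdivrMr ?ltr0n// mulrC -ltr_pdivrMr// truncnS_gt.
have [j Fj] := nonincreasing_measure_lt (fun j => mD _) nF F0 e0.
exists j.+1%:R^-1; first by rewrite invr_gt0 ltr0n.
move=> eps' /andP[_ le]; split; first exact: mD.
apply: le_lt_trans Fj; apply: le_measure; rewrite ?inE; try exact: mD.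
exact: sD.
Qed.

End boundary_null.

(** * Uniform lower bound on the choice probabilities *)

Section choice_prob_bound.
Context {R : realType} {n : nat}.
Notation V := (n.-tuple R).
Variables (sigma eta : probability V R).
Hypothesis hsigma : uniform_spherical sigma.

(** [charged_boundary] does not place its point on the sphere. But sigma is carried by the sphere,
    so every ball around a0 contains a vector of norm 1, and the norm of a0 is arbitrarily close to
    1. *)
Lemma charged_point_unit_sphere (a0 : V) :
  (forall rho : R, 0 < rho -> (0 < sigma (eball a0 rho))%E) -> unit_sphere a0.
Proof.
move=> ch; rewrite /unit_sphere/=; apply/eqP; rewrite -subr_eq0 -normr_eq0.
rewrite eq_le normr_ge0 andbT; apply/ler_addgt0Pr => e e0; rewrite add0r.
have [x [xe sx]] : exists x, eball a0 e x /\ unit_sphere x.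
  apply: contrapT => /forallNP h.
  have := ch _ e0; rewrite lt_neqAle => /andP[/eqP + _]; apply; apply/esym.
  apply: (subset_measure0 (B := ~` unit_sphere)).
  - exact: measurable_eball.
  - by apply: measurableC; exact: measurable_unit_sphere.
  - by move=> x xe sx; apply: (h x).
  - exact: uniform_off_sphere hsigma.
rewrite eballE in xe; move: sx; rewrite /unit_sphere/= => sx.
have h1 : enorm a0 <= enorm x + tdist a0 x.
  rewrite tdistE.
  have -> : enorm a0 = enorm (lincomb 1 x 1 (lincomb 1 a0 (-1) x)).
    by congr enorm; apply: eq_from_tnth => i; rewrite !tnth_mktuple; ring.
  by apply: le_trans (ler_enormD _ _ _ _) _; rewrite normr1 !mul1r.
have h2 : enorm x <= enorm a0 + tdist x a0.
  rewrite tdistE.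
  have -> : enorm x = enorm (lincomb 1 a0 1 (lincomb 1 x (-1) a0)).
    by congr enorm; apply: eq_from_tnth => i; rewrite !tnth_mktuple; ring.
  by apply: le_trans (ler_enormD _ _ _ _) _; rewrite normr1 !mul1r.
rewrite tdistC in h1; rewrite sx in h1 h2.
rewrite ler_norml; apply/andP; split; lra.
Qed.

Variables (f : V -> R) (a0 : V) (rho : R).
Hypothesis fE : is_density sigma eta f.
Hypothesis rho0 : 0 < rho.
Hypothesis f0 : forall x, eball a0 rho x -> 0 < f x.
Hypothesis ch : forall e : R, 0 < e -> (0 < sigma (eball a0 e))%E.

(* a1 is the projection on the sphere of a0 + kappa u. *)
Lemma half_ball (u : V) (kappa : R) : unit_sphere a0 -> unit_sphere u ->
  0 < kappa <= 2^-1 -> - (kappa / 2) <= dot u a0 ->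
  exists2 a1, unit_sphere a1 &
    forall a, eball a1 (kappa / 4) a -> tdist a a0 < 3 * kappa /\ 0 < dot u a.
Proof.
move=> sa0 su /andP[k0 k2] ua0.
pose w := lincomb 1 a0 kappa u.
have w1 : enorm w <= 1 + kappa.
  by apply: le_trans (ler_enormD _ _ _ _) _; rewrite normr1 (gtr0_norm k0) sa0 su !mulr1.
have w2 : 1 - kappa <= enorm w.
  have : enorm a0 <= enorm w + kappa.
    have -> : enorm a0 = enorm (lincomb 1 w (- kappa) u).
      by congr enorm; apply: eq_from_tnth => i; rewrite !tnth_mktuple; ring.
    apply: le_trans (ler_enormD _ _ _ _) _.
    by rewrite normr1 normrN (gtr0_norm k0) su mul1r mulr1.
  rewrite sa0; lra.
have w0 : 0 < enorm w by lra.
pose a1 := lincomb (enorm w)^-1 w 0 w.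
have sa1 : unit_sphere a1.
  by rewrite /unit_sphere/= enorm_scale gtr0_norm ?invr_gt0// mulVf ?gt_eqF.
exists a1 => // a; rewrite eballE => aa1; split.
  (* Normalizing w moves it by | |w| - 1 | <= kappa, and w is at distance kappa from a0: in total
     less than kappa / 4 + 2 kappa < 3 kappa. *)
  have d1 : tdist a1 w <= kappa.
    rewrite tdistE.
    have -> : enorm (lincomb 1 a1 (-1) w) = enorm (lincomb (1 - enorm w) a1 0 a1).
      congr enorm; apply: eq_from_tnth => i; rewrite !tnth_mktuple.
      by field; rewrite gt_eqF.
    by rewrite enorm_scale sa1 mulr1 ler_norml; apply/andP; split; lra.
  have d2 : tdist w a0 <= kappa.
    rewrite tdistE.
    have -> : enorm (lincomb 1 w (-1) a0) = enorm (lincomb kappa u 0 u).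
      by congr enorm; apply: eq_from_tnth => i; rewrite !tnth_mktuple; ring.
    by rewrite enorm_scale su mulr1 gtr0_norm.
  have := tdist_triangle a1 a a0; have := tdist_triangle w a1 a0; lra.
have : dot u a1 <= dot u a + enorm u * tdist a1 a by exact: ler_dot_tdist.
rewrite su mul1r tdistC.
(* u'w = u'a0 + kappa >= kappa / 2, and dividing by |w| <= 2 leaves kappa / 4, the radius of the
   ball around a1. *)
have : kappa / 4 <= dot u a1.
  rewrite dot_lincombr mul0r addr0 dot_lincombr mul1r.
  move/unit_sphereP : su => ->; rewrite mulr1 [leRHS]mulrC ler_pdivlMr//.
  apply: (@le_trans _ _ (kappa / 2)); last by lra.
  by rewrite (_ : kappa / 2 = kappa / 4 * 2); [rewrite ler_wpM2l//; lra|field].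
lra.
Qed.

(** Each half-space in question contains a ball of radius kappa / 4 centred on the sphere and inside
    [eball a0 rho]. Its spherical measure s depends on neither x nor y, so [density_lower_bound]
    yields one c for all. *)
Lemma choice_prob_lower_bound : exists kappa c : R, [/\ 0 < kappa, 0 < c &
  forall x y, 0 < enorm x -> `|dot x a0| <= kappa * enorm x -> c <= choice_prob eta x y].
Proof.
have sa0 := charged_point_unit_sphere ch.
(* The bound 1 / 2 keeps a0 + kappa u away from the origin; rho / 3 keeps the small balls, which lie
   within 3 kappa of a0, where f is positive. *)
pose kappa := Num.min 2^-1 (rho / 3).
have k0 : 0 < kappa by rewrite lt_min invr_gt0 ltr0n divr_gt0.
have k2 : kappa <= 2^-1 by rewrite ge_min lexx.
have k3 : 3 * kappa <= rho by rewrite -ler_pdivlMl// mulrC ge_min lexx orbT.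
pose s := fine (sigma (eball a0 (kappa / 4))).
have sfin : sigma (eball a0 (kappa / 4)) \is a fin_num.
  by rewrite fin_num_measure//; exact: measurable_eball.
have s0 : 0 < s by rewrite -lte_fin fineK// ch// divr_gt0.
have [c c0 hc] := density_lower_bound fE (measurable_eball a0 rho) f0 s0.
exists (kappa / 2), c; split=> //; first by rewrite divr_gt0.
move=> x y x0 xa0.
(* The sign turns the unit normal towards the side of the hyperplane on which the choice is y. *)
pose e : R := if y then 1 else -1.
have e1 : `|e| = 1 by rewrite /e; case: ifP => _; rewrite ?normrN normr1.
pose u := lincomb (e / enorm x) x 0 x.
have su : unit_sphere u.
  by rewrite /unit_sphere/= enorm_scale normrM e1 mul1r normfV gtr0_norm ?mulVf ?gt_eqF.
have uE a : dot u a = e * (dot x a / enorm x).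
  by rewrite dot_lincombl mul0r addr0; ring.
have ua0 : - (kappa / 2) <= dot u a0.
  rewrite lerNl (le_trans (ler_norm _))// normrN uE normrM e1 mul1r normrM.
  by rewrite normfV (gtr0_norm x0) ler_pdivrMr.
have [|a1 sa1 ha1] := half_ball sa0 su _ ua0; first by rewrite k0.
rewrite -lee_fin choice_probE.
apply: (@le_trans _ _ (eta (eball a1 (kappa / 4)))).
  apply: hc; first exact: measurable_eball.
    by move=> a /ha1[+ _]; rewrite eballE => /lt_le_trans; apply.
  by rewrite (uniform_eball hsigma _ sa1 sa0) fineK.
apply: le_measure; rewrite ?inE; [exact: measurable_eball|exact: measurable_choice_set|].
move=> a /ha1[_]; rewrite uE mulrA pmulr_lgt0 ?invr_gt0// /choice_set/= /e.
case: (y); first by rewrite mul1r => /ltW.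
by rewrite mulN1r oppr_gt0 => xa; apply/negbTE; rewrite -ltNge.
Qed.

End choice_prob_bound.

(** * Unboundedness of the efficiency bound *)

Section irregularity.
Context {R : realType} {m : nat}.
Notation V := (m.+1.-tuple R).
Variables (sigma PX eta0 : probability V R).
Hypothesis hsigma : uniform_spherical sigma.
Hypothesis hX : pushforward PX normalize `<< sigma \/
  (PX [set x | thead x = 1] = 1%E /\
   forall a2 : m.-tuple R, (exists i, tnth a2 i != 0) ->
     pushforward PX (fun x => dot a2 (behead_tuple x)) `<< lebesgue_measure).

Definition contrast (A C : set V) (a : V) : R :=
  \1_A a / fine (eta0 A) - \1_C a / fine (eta0 C).

Lemma contrast_Lfun2 (A C : set V) : measurable A -> measurable C ->
  contrast A C \in Lfun eta0 2%:E.
Proof.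
move=> mA mC; rewrite (_ : contrast A C =
  (fine (eta0 A))^-1 *: (\1_A : V -> R) - (fine (eta0 C))^-1 *: (\1_C : V -> R)).
  have Z (E : set V) (p : R) : measurable E -> p *: (\1_E : V -> R) \in Lfun eta0 2%:E.
    by move=> /(Lfun2_indic eta0) E2; rewrite rpredZ// lee1n.
  by have := Z _ (fine (eta0 C))^-1 mC; have := Z _ (fine (eta0 A))^-1 mA => *; rewrite rpredB// lee1n.
by apply/funext => a; rewrite /contrast mulrC [X in _ - X]mulrC.
Qed.

Lemma Rintegral_contrast (A C D : set V) : measurable A -> measurable C ->
  measurable D ->
  \int[eta0]_(a in D) contrast A C a =
    fine (eta0 (A `&` D)) / fine (eta0 A) - fine (eta0 (C `&` D)) / fine (eta0 C).
Proof.
move=> mA mC mD.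
have intI (E : set V) : measurable E -> eta0.-integrable D (EFin \o (\1_E : V -> R)).
  by move=> mE; apply: (integrableS measurableT) => //; exact: integrable_indic.
have intIZ (E : set V) (p : R) : measurable E ->
    eta0.-integrable D (EFin \o (fun a => \1_E a / p)).
  move=> mE; rewrite (_ : _ \o _ = fun a => (p^-1%:E * (\1_E a)%:E)%E).
    by apply: integrableZl => //; exact: intI.
  by apply/funext => a; rewrite /= mulrC.
rewrite /contrast RintegralB//; [|exact: intIZ|exact: intIZ].
rewrite !RintegralZr//; [|exact: intI|exact: intI].
by rewrite /Rintegral !integral_indic.
Qed.

Lemma vanishing_test_scores (B : set V) (e : R) : measurable B ->
  charged_boundary sigma eta0 B -> 0 < e ->
  exists b, [/\ L20 eta0 b, \int[eta0]_(a in B) b a = 1 &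
    ('E_(PX \x eta0)[fun w => (cond_mean eta0 b (outcome w) ^+ 2)%R] <= e%:E)%E].
Proof.
move=> mB [a0 [ch [f [rho [fE rho0 f0]]]]] e0.
have chU (r : R) : 0 < r -> (0 < sigma (eball a0 r))%E.
  move=> r0; apply: lt_le_trans (ch r r0).1 _; apply: measureIr => //.
  exact: measurable_eball.
have sa0 := charged_point_unit_sphere hsigma chU.
have [kappa [c [k0 c0 pc]]] := choice_prob_lower_bound hsigma fE rho0 f0 chU.
(* The squared conditional mean will be at most c^-2 on D and 0 elsewhere, so probability e c^2 for
   D suffices. *)
have ec0 : 0 < e * c ^+ 2 by rewrite mulr_gt0// exprn_gt0.
have [eps0 eps00 hD] := regressor_near_hyperplane hsigma hX sa0 ec0.
(* kappa gives the choice bound on D, rho the positivity of the density on U, and eps0 the small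
   probability of D. *)
pose eps := Num.min (Num.min kappa rho) eps0.
have eps_gt0 : 0 < eps by rewrite !lt_min k0 rho0 eps00.
have eps_k : eps <= kappa by rewrite !ge_min lexx.
have eps_r : eps <= rho by rewrite !ge_min lexx orbT.
have eps_0 : eps <= eps0 by rewrite ge_min lexx orbT.
have [|mD PD] := hD eps; first by rewrite eps_gt0.
set D := [set x : V | _] in mD PD.
pose U := eball a0 eps.
have mU : measurable U := measurable_eball _ _.
have UP (E : set V) : measurable E -> (0 < sigma (E `&` U))%E -> 0 < fine (eta0 (E `&` U)).
  move=> mE s0; have mEU : measurable (E `&` U) by exact: measurableI.
  have sfin : sigma (E `&` U) \is a fin_num by exact: fin_num_measure.
  have s1 : 0 < fine (sigma (E `&` U)) by rewrite -lte_fin fineK.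
  have [d d0 hd] := density_lower_bound fE (measurable_eball a0 rho) f0 s1.
  have pfin : eta0 (E `&` U) \is a fin_num by exact: fin_num_measure.
  rewrite -lte_fin fineK//; apply: (@lt_le_trans _ _ d%:E); first by rewrite lte_fin.
  apply: hd => //; last by rewrite fineK.
  by move=> a [_]; rewrite /U !eballE => /lt_le_trans; apply.
have mA : measurable (B `&` U) by exact: measurableI.
have mC : measurable (~` B `&` U) by apply: measurableI => //; exact: measurableC.
have p1 := UP _ mB (ch _ eps_gt0).1.
have p2 := UP _ (measurableC mB) (ch _ eps_gt0).2.
pose b := contrast (B `&` U) (~` B `&` U).
have intb : eta0.-integrable setT (EFin \o b).
  exact/Lfun2_integrable/contrast_Lfun2.
have bE S : measurable S -> U `<=` S \/ U `&` S = set0 -> \int[eta0]_(a in S) b a = 0.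
  move=> mS; rewrite Rintegral_contrast// => -[US|US].
    have E X : X `&` U `&` S = X `&` U by apply: setIidl => a [_ /US].
    by rewrite !E !divff ?gt_eqF ?subrr.
  by rewrite -!setIA US !setI0 measure0 !mul0r subrr.
(* The integral is the conditional probability of S given B & U minus that given U - B, hence
   bounded independently of eps. *)
have b_le1 S : measurable S -> `|\int[eta0]_(a in S) b a| <= 1.
  move=> mS; rewrite Rintegral_contrast//.
  have E X : measurable X -> 0 < fine (eta0 X) -> 0 <= fine (eta0 (X `&` S)) / fine (eta0 X) <= 1.
    move=> mX X0; rewrite divr_ge0 ?fine_ge0//= ler_pdivrMr// mul1r fine_le//.
    - by rewrite fin_num_measure//; exact: measurableI.
    - by rewrite fin_num_measure.
    - exact: measureIl.
  have /andP[? ?] := E _ mA p1; have /andP[? ?] := E _ mC p2.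
  by rewrite ler_norml; apply/andP; split; lra.
(* For |x| = 0 the choice is constant because x'a = 0 for every a; otherwise the hyperplane is
   farther from a0 than the radius of U. *)
have sgnU x : ~ (0 < enorm x /\ D x) -> exists y0, forall a, U a -> (0 <= dot x a) = y0.
  move=> xD; have [xpos|xneg] := ltP 0 (enorm x); last first.
    exists true => a _; have x0 : enorm x = 0 by apply/eqP; rewrite eq_le xneg enorm_ge0.
    by have := Cauchy_Schwarz_dot x a; rewrite x0 mul0r normr_le0 => /eqP ->; rewrite lexx.
  have {}xD : eps * enorm x < `|dot x a0|.
    by rewrite ltNge; apply/negP => xD'; apply: xD.
  have near a : U a -> enorm x * tdist a a0 <= eps * enorm x.
    by rewrite /U eballE => /ltW aU; rewrite mulrC ler_wpM2r// enorm_ge0.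
  have [xa0|xa0] := leP 0 (dot x a0).
    exists true => a /near aU; move: xD; rewrite ger0_norm// => xD.
    have := ler_dot_tdist x a0 a; rewrite tdistC => h.
    by lra.
  exists false => a /near aU; move: xD; rewrite ltr0_norm// => xD.
  have := ler_dot_tdist x a a0 => h.
  by apply/negbTE; rewrite -ltNge; lra.
exists b; split.
- split; first exact: contrast_Lfun2.
  rewrite unlock -EFin_Rintegral//.
  by rewrite bE//; left.
- rewrite Rintegral_contrast//.
  rewrite (_ : B `&` U `&` B = B `&` U); last by rewrite setIAC setIid.
  rewrite (_ : ~` B `&` U `&` B = set0); last by rewrite setIAC setICl set0I.
  by rewrite measure0 mul0r subr0 divff// gt_eqF.
have bnd z : cond_mean eta0 b z ^+ 2 <= (c ^+ 2)^-1 * \1_D z.2.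
  case: z => y x; rewrite /cond_mean/= indicE.
  have mS := measurable_choice_set x y.
  have [[x0 xD]|xD] := pselect (0 < enorm x /\ D x).
    rewrite mem_set// mulr1 -exprVn -(real_normK (num_real _)).
    rewrite ler_pXn2r ?nnegrE ?invr_ge0 ?(ltW c0)// normrM normfV -[leRHS]mul1r.
    have pc' : c <= choice_prob eta0 x y.
      by apply: pc => //; apply: (le_trans xD); rewrite ler_wpM2r// enorm_ge0.
    have p0 := lt_le_trans c0 pc'.
    by rewrite (gtr0_norm p0) ler_pM ?invr_ge0 ?(ltW p0) ?b_le1// lef_pV2.
  have [y0 hy0] := sgnU _ xD.
  rewrite bE//; first by rewrite mul0r expr0n/= mulr_ge0// invr_ge0 exprn_ge0// ltW.
  have [yy|yy] := eqVneq y0 y; [left|right].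
    by move=> a /hy0; rewrite /choice_set/= yy.
  rewrite -subset0 => a [/hy0 h]; rewrite /choice_set/= h => /eqP.
  by rewrite (negbTE yy).
rewrite unlock.
have mDT : measurable (D `*` [set: V]) by exact: measurableX.
apply: (@le_trans _ _ (\int[PX \x eta0]_w (((c ^+ 2)^-1)%:E * (\1_(D `*` [set: V]) w)%:E))%E).
  apply: ge0_le_integral => //.
  - by move=> w _; rewrite lee_fin sqr_ge0.
  - apply/measurable_EFinP; apply: measurable_funX.
    exact: measurableT_comp (measurable_cond_mean PX intb) measurable_outcome.
  - by apply: measurable_funeM; apply/measurable_EFinP.
  - move=> w _; rewrite lee_fin (le_trans (bnd _))// !indicE.
    by rewrite in_setX in_setT andbT.
rewrite ge0_integralZl//; [|by apply/measurable_EFinP|by rewrite lee_fin invr_ge0 exprn_ge0// ltW].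
rewrite integral_indic// setIT.
rewrite [X in (_ * X)%E](_ : _ = PX D); last first.
  transitivity (PX D * eta0 [set: V])%E; first exact: product_measure1E.
  by rewrite [X in (_ * X)%E](_ : _ = 1%E) ?mule1//; exact: probability_setT.
have PDfin : PX D \is a fin_num by exact: fin_num_measure.
move: PD; rewrite -(fineK PDfin) -EFinM lte_fin lee_fin => PD.
by rewrite mulrC ler_pdivrMr ?exprn_gt0// ltW.
Qed.

Variable H : set (probability V R).
Hypothesis hnp : nonparametric sigma H eta0.

Lemma score_Lfun2 b : is_score sigma H eta0 b -> b \in Lfun eta0 2%:E.
Proof. by move=> [path []]. Qed.

(** Both sides are linear in b. Membership in L_2 is carried through the induction because
    additivity of the integrals requires integrability. *)
Lemma gradient_tangent_space (r : V -> R) (B : set V) (c : R) : measurable B ->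
  r \in Lfun eta0 2%:E ->
  (forall b, is_score sigma H eta0 b ->
    ('E_eta0[(r \* b)%R] = (c * \int[eta0]_(x in B) b x)%R%:E)%E) ->
  forall b, tangent_space sigma H eta0 b -> b \in Lfun eta0 2%:E /\
    ('E_eta0[(r \* b)%R] = (c * \int[eta0]_(x in B) b x)%R%:E)%E.
Proof.
move=> mB r2 hr b [k [d [s [hs ->]]]].
pose P (b : V -> R) := b \in Lfun eta0 2%:E /\
  \int[eta0]_x (r x * b x) = c * \int[eta0]_(x in B) b x.
have intr b' : b' \in Lfun eta0 2%:E -> eta0.-integrable setT (EFin \o (fun x => r x * b' x)).
  by move=> b2; apply/Lfun1_integrable; exact: Lfun2_mul_Lfun1.
have int1 b' : b' \in Lfun eta0 2%:E -> eta0.-integrable B (EFin \o b').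
  by move=> b2; apply: (integrableS measurableT) => //; exact: Lfun2_integrable.
suff [b2 bE] : P (fun a => \sum_(i < k) d i * s i a).
  by split=> //; rewrite unlock -EFin_Rintegral ?bE//; exact: intr.
rewrite (_ : (fun a => _) = \sum_(i < k) (d i *: s i)); last first.
  by apply/funext => a; rewrite fct_sumE.
apply: (big_ind P).
- split; first by rewrite rpred0// lee1n.
  rewrite /Rintegral [in LHS]integral0_eq => [|x _]; last by rewrite mulr0.
  by rewrite integral0_eq// mulr0.
- move=> g h [g2 gE] [h2 hE]; split; first by rewrite rpredD// lee1n.
  under eq_Rintegral do rewrite mulrDr.
  rewrite RintegralD//; [|exact: intr|exact: intr].
  by rewrite RintegralD// ?gE ?hE ?mulrDr//; exact: int1.
- move=> i _; have s2 := score_Lfun2 (hs i); split; first by rewrite rpredZ// lee1n.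
  under eq_Rintegral do rewrite [X in _ * X]/(GRing.scale _ _ _) mulrCA.
  rewrite RintegralZl//; last exact: intr.
  have -> : \int[eta0]_x (r x * s i x) = c * \int[eta0]_(x in B) s i x.
    apply: EFin_inj; rewrite -(hr _ (hs i)) unlock EFin_Rintegral//; exact: intr.
  by rewrite mulrCA; congr (_ * _); rewrite -RintegralZl//; exact: int1.
Qed.

(** Turns the extended-real supremum of ratios into a real inequality without division; the upper
    bound w ensures that the second moment is finite. *)
Lemma efficiency_bound_lty (r : V -> R) :
  r \in Lfun eta0 2%:E -> (efficiency_bound sigma H PX eta0 r < +oo)%E ->
  exists2 K : R, 0 < K & forall b h (w : R), b \in Lfun eta0 2%:E ->
    tangent_space sigma H eta0 b -> score_operator PX eta0 b h ->
    ('E_(PX \x eta0)[fun z => (h (outcome z) ^+ 2)%R] <= w%:E)%E ->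
    (fine 'E_eta0[(r \* b)%R]) ^+ 2 <= K * w.
Proof.
move=> r2 bnd; set S := efficiency_bound _ _ _ _ _ in bnd.
have [K K0 SK] : exists2 K : R, 0 < K & (S <= K%:E)%E.
  case: S bnd => [s _|//|_].
  - exists (Num.max s 1); first by rewrite lt_max ltr01 orbT.
    by rewrite lee_fin le_max lexx.
  - by exists 1 => //; rewrite leNye.
exists K => // b h w b2 Tb hb hw.
have Efin : ('E_eta0[(r \* b)%R])%E \is a fin_num.
  by apply: expectation_fin_num; exact: Lfun2_mul_Lfun1.
have := ereal_sup_ubound (_ : [set v | exists b h,
    [/\ tangent_space sigma H eta0 b, score_operator PX eta0 b h &
      v = ('E_eta0[(r \* b)%R] ^+ 2 /
           'E_(PX \x eta0)[fun w => (h (outcome w) ^+ 2)%R])%E]] _).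
move=> /(_ _ (ex_intro _ b (ex_intro _ h (And3 Tb hb erefl)))) => /le_trans/(_ SK).
rewrite -(fineK Efin); set x := fine _.
have E0 : (0 <= 'E_(PX \x eta0)[fun z => (h (outcome z) ^+ 2)%R])%E.
  by apply: expectation_ge0 => z; exact: sqr_ge0.
have wfin : ('E_(PX \x eta0)[fun z => (h (outcome z) ^+ 2)%R])%E \is a fin_num.
  by rewrite ge0_fin_numE// (le_lt_trans hw)// ltry.
move: E0 hw; rewrite -(fineK wfin); set v := fine _; rewrite !lee_fin => v0 vw.
(* With denominator 0, a nonzero numerator would make the ratio +oo, above K. *)
rewrite -EFin_expe inver; have [v00|v00] := eqVneq v 0.
  have [->|x0] := eqVneq x 0; first by rewrite expr0n/= mulr_ge0 ?(ltW K0)// (le_trans v0).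
  by rewrite gt0_muley ?lte_fin ?lt_neqAle 1?eq_sym ?sqrf_eq0 ?x0 ?sqr_ge0//.
rewrite -EFinM lee_fin ler_pdivrMr ?lt_neqAle 1?eq_sym ?v00// => /le_trans; apply.
by rewrite ler_wpM2l// ltW.
Qed.

(** The common core of both claims: the CDF has c = 1, and the quantile has c = - 1 / f(q), with f
    the marginal density. *)
Lemma not_regularly_identified (phi : probability V R -> R) (B : set V) (c : R) :
  measurable B -> c != 0 -> charged_boundary sigma eta0 B ->
  (forall r path b, is_gradient sigma H eta0 phi r ->
     path_with_score sigma H eta0 path b ->
     ('E_eta0[(r \* b)%R] = (c * \int[eta0]_(x in B) b x)%R%:E)%E) ->
  ~ regularly_identified sigma H PX eta0 phi.
Proof.
move=> mB c0 chB hgrad [_ [r gr bnd]].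
have r2 : r \in Lfun eta0 2%:E by case: gr => -[].
have hT := gradient_tangent_space mB r2 (fun b '(ex_intro path pb) => hgrad _ _ _ gr pb).
have [K K0 hK] := efficiency_bound_lty r2 bnd.
have c2 : 0 < c ^+ 2 by rewrite lt_neqAle eq_sym sqrf_eq0 c0 sqr_ge0.
(* e <= 1 / 4 will give E[1_B b] >= 1 / 2, hence c^2 / 4 <= (E[r b])^2 <= 4 e K, while the second
   bound makes 4 e K <= c^2 / 8. *)
pose e := Num.min 4^-1 (c ^+ 2 / (32 * K)).
have e0 : 0 < e by rewrite lt_min invr_gt0 ltr0n divr_gt0// mulr_gt0.
have e4 : e <= 4^-1 by rewrite ge_min lexx.
have eK : e * (32 * K) <= c ^+ 2 by rewrite -ler_pdivlMr ?mulr_gt0// ge_min lexx orbT.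
have [bs [bs0 bsB Ebs]] := vanishing_test_scores mB chB e0.
have [b Tb Eb] := hnp bs0 e0.
have [b2 rbE] := hT _ Tb.
have bs2 := bs0.1.
have int1 k : k \in Lfun eta0 2%:E -> eta0.-integrable setT (EFin \o k).
  by move=> k2; exact: Lfun2_integrable.
have hw : ('E_(PX \x eta0)[fun z => (cond_mean eta0 b (outcome z) ^+ 2)%R] <= (4 * e)%:E)%E.
  apply: (le_trans (le_expectation_cond_mean_sqr PX b2 bs2)).
  rewrite [leRHS](_ : _ = (2%:E * e%:E + 2%:E * e%:E)%E); last first.
    by rewrite -!EFinM -EFinD; congr (_%:E); ring.
  by apply: leeD; apply: lee_wpmul2l => //; exact: ltW.
have := hK _ _ _ b2 Tb (score_operator_cond_mean PX (int1 _ b2)) hw.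
rewrite rbE/= exprMn.
have d2 : (fun a => bs a - b a) \in Lfun eta0 2%:E.
  by rewrite (_ : (fun a => _) = bs - b)// rpredB// lee1n.
have intd2 := Lfun2_integrable_sqr d2.
(* AM-GM with l = 2 and the empty set as smaller set: E[1_B (bs - b)] is at most e + 1 / 4 <= 1 / 2
   in absolute value. *)
have dB := le_Rintegral_setD (ltr0n R 2) d2 measurable0 mB (@sub0set _ B).
rewrite Rintegral_set0 subr0 measure0/= subr0 in dB.
have de : \int[eta0]_a (bs a - b a) ^+ 2 < e.
  by rewrite -lte_fin EFin_Rintegral//; move: Eb; rewrite unlock.
have B1 : fine (eta0 B) <= 1.
  by rewrite -lee_fin fineK ?fin_num_measure// probability_le1.
have bB : 2^-1 <= \int[eta0]_(a in B) b a.
  move: dB; rewrite RintegralB//; try by apply: integrableS (int1 _ _).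
  rewrite bsB ler_norml => /andP[_]; lra.
have : 4^-1 <= (\int[eta0]_(a in B) b a) ^+ 2.
  rewrite (_ : 4^-1 = 2^-1 ^+ 2); last by field.
  by rewrite ler_pXn2r ?nnegrE ?invr_ge0// (le_trans _ bB)// invr_ge0.
set I := (\int[eta0]_(a in B) b a) ^+ 2 => hI hle.
have : c ^+ 2 * 4^-1 <= c ^+ 2 * I by rewrite ler_wpM2l// ltW.
nra.
Qed.

End irregularity.

Theorem corollary4p1 (R : realType) (m : nat) (hm : (0 < m)%N)
    (sigma : probability (m.+1.-tuple R) R) (hsigma : uniform_spherical sigma)
    (H : set (probability (m.+1.-tuple R) R))
    (hH : forall eta, H eta -> eta `<< sigma)
    (eta0 : probability (m.+1.-tuple R) R) (heta0 : H eta0)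
    (hnp : nonparametric sigma H eta0)
    (PX : probability (m.+1.-tuple R) R)
    (hX : pushforward PX normalize `<< sigma \/
          (PX [set x | thead x = 1] = 1%E /\
           forall a2 : m.-tuple R, (exists i, tnth a2 i != 0) ->
             pushforward PX (fun x => dot a2 (behead_tuple x))
               `<< lebesgue_measure)) :
  (forall a : m.+1.-tuple R, charged_boundary sigma eta0 (orthant a) ->
     ~ regularly_identified sigma H PX eta0 (cdf_at a)) /\
  (forall (k : 'I_m.+1) (tau : R), 0 < tau < 1 ->
     regular_marginal k eta0 (quantile k tau eta0) ->
     charged_boundary sigma eta0 [set a | tnth a k <= quantile k tau eta0] ->
     ~ regularly_identified sigma H PX eta0 (quantile k tau)).
Proof.
split=> [a chB|k tau tau01 [f [_ fpos dF]] chB].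
- apply: (not_regularly_identified hsigma hX hnp (measurable_orthant a) _ chB).
    exact: oner_neq0.
  by move=> r path b; exact: gradient_cdf_at.
- have f0 : 0 < f (quantile k tau eta0) := nbhs_singleton fpos.
  apply: (not_regularly_identified (c := - (f (quantile k tau eta0))^-1) hsigma hX hnp
    (measurable_tnth_le k _) _ chB).
    by rewrite oppr_eq0 invr_eq0; exact: lt0r_neq0 f0.
  by move=> r path b; exact: gradient_quantile.
Qed.
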